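(* Let $(\Omega,\mathcal{A},\mu)$ be a complete finite measure space, let $\varphi\in\Delta_2$ be a Young function and let $\{\mathcal{A}_n\}_{n=1}^{\infty}$ be a sequence of $\sigma$-subalgebras of $\mathcal{A}$, with lower limit $\underline{\mathcal{A}}=\bigvee_{m=1}^{\infty}\bigcap_{n=m}^{\infty}\mathcal{A}_n$. Then $\mathcal{A}_n\xrightarrow{\perp}\underline{\mathcal{A}}$ if and only if for every $f\in L^{\varphi}(\mathcal{A})$, $E(f\mid\mathcal{A}_n)\to E(f\mid\underline{\mathcal{A}})$ in the norm of $L^{\varphi}(\mathcal{A})$.
   Context: A Young function is a continuous convex function $\varphi:\mathbb{R}\to\mathbb{R}$ that is even, satisfies $\varphi(x)=0$ if and only if $x=0$, and satisfies $\lim_{x\to\infty}\varphi(x)/x=\infty$ and $\lim_{x\to\infty}\varphi(x)=\infty$. Its complementary Young function is $\psi(y)=\sup\{x|y|-\varphi(x):x\ge 0\}$. We write $\varphi\in\Delta_2$ if there are constants $k>0$, $x_0>0$ with $\varphi(2x)\le k\varphi(x)$ for all $x\ge x_0$. The Orlicz space $L^{\varphi}(\mathcal{A})=L^{\varphi}(\Omega,\mathcal{A},\mu)$ is the space of (a.e. classes of) real-valued $\mathcal{A}$-measurable $f$ with $\int_\Omega\varphi(\alpha f)\,d\mu<\infty$ for some $\alpha>0$, with norm $\|f\|_\varphi=N_\varphi(f)=\inf\{k>0:\int_\Omega\varphi(|f|/k)\,d\mu\le 1\}$. For a $\sigma$-subalgebra $\mathfrak{D}\subseteq\mathcal{A}$,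 $E(f\mid\mathfrak{D})$ is the a.e. unique $\mathfrak{D}$-measurable function with $\int_D f\,d\mu=\int_D E(f\mid\mathfrak{D})\,d\mu$ for all $D\in\mathfrak{D}$; put $E_{\mathfrak{D}}^{\perp}(f)=f-E(f\mid\mathfrak{D})$. For a family of $\sigma$-subalgebras, $\bigvee$ denotes the smallest $\sigma$-subalgebra of $\mathcal{A}$ containing their union. Orthogonal convergence (in $L^\varphi(\mathcal{A})$): $\mathcal{A}_n\xrightarrow{\perp}\mathfrak{D}$ means that for every sequence $\{A_n\}$ with $A_n\in\mathcal{A}_n$ one has $E_{\mathfrak{D}}^{\perp}(\chi_{A_n})\to 0$ weakly in $L^{\varphi}(\mathcal{A})$; since $\varphi\in\Delta_2$ gives $(L^{\varphi})^*=L^{\psi}$, this means $\int_\Omega E_{\mathfrak{D}}^{\perp}(\chi_{A_n})\,g\,d\mu\to 0$ for every $g\in L^{\psi}(\mathcal{A})$. *)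

(* Defs.v *)
From HB Require Import structures.
From mathcomp Require Import all_boot all_order all_algebra.
From mathcomp Require Import all_classical all_reals all_analysis.

Set Implicit Arguments.
Unset Strict Implicit.
Unset Printing Implicit Defensive.

Import Order.TTheory GRing.Theory Num.Theory.
Import numFieldNormedType.Exports.

Local Open Scope classical_set_scope.
Local Open Scope ring_scope.

Section young_functions.
Context {R : realType}.
Implicit Types phi : R -> R.

Record young_function phi : Prop := YoungFunction {
  young_continuous : continuous phi ;
  young_convex : convex_function [set: R^o] phi ;
  young_even : forall x, phi (- x) = phi x ;
  young_eq0 : forall x, phi x = 0 <-> x = 0 ;
  young_superlinear : phi x / x @[x --> +oo] --> +oo ;
  young_unbounded : phi x @[x --> +oo] --> +oo }.

(* For a Young function the set below is nonempty and bounded above (by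
   superlinearity), so the real-valued [sup] is the true supremum. *)
Definition complementary phi (y : R) : R :=
  sup [set x * `|y| - phi x | x in [set x : R | 0 <= x]].

Definition Delta2 phi : Prop :=
  exists k x0 : R, [/\ 0 < k, 0 < x0 &
    forall x, x0 <= x -> phi (2 * x) <= k * phi x].

End young_functions.

Section orlicz_spaces.
Context {d : measure_display} {T : measurableType d} {R : realType}.
Variable mu : {measure set T -> \bar R}.
Implicit Types (phi : R -> R) (f g : T -> R).

(* Elements of the Orlicz space are represented by functions; everything below
   depends only on their classes modulo equality almost everywhere. *)
Definition orlicz_space phi : set (T -> R) :=
  [set f | measurable_fun [set: T] f /\
    exists2 alpha : R, 0 < alpha &
      (\int[mu]_x (phi (alpha * f x))%:E < +oo)%E].

(* Luxemburg norm; the infimum is taken in the extended reals, so that it is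
   [+oo], and not a default value, when no k is admissible. *)
Definition orlicz_norm phi f : \bar R :=
  ereal_inf [set k%:E | k in
    [set k : R | 0 < k /\ (\int[mu]_x (phi (`|f x| / k))%:E <= 1)%E]].

Definition orlicz_cvg phi (u : nat -> T -> R) (f : T -> R) : Prop :=
  orlicz_norm phi (u n \- f) @[n --> \oo] --> 0%E.

(* Weak convergence to 0 in L^phi, the dual of L^phi being identified with
   L^psi, psi the complementary function (phi is Delta2 in all uses). *)
Definition orlicz_weak_cvg0 phi (u : nat -> T -> R) : Prop :=
  forall g, orlicz_space (complementary phi) g ->
    (\int[mu]_x (u n x * g x)%:E)%E @[n --> \oo] --> 0%E.

End orlicz_spaces.

Section sub_sigma_algebras.
Context {d : measure_display} {T : measurableType d}.

Definition is_sub_sigma_algebra (D : set (set T)) : Prop :=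
  sigma_algebra [set: T] D /\ D `<=` measurable.

Definition sigma_join (B : nat -> set (set T)) : set (set T) :=
  <<s \bigcup_m B m >>.

Definition lower_limit (A : nat -> set (set T)) : set (set T) :=
  sigma_join (fun m => \bigcap_(n >= m) A n).

End sub_sigma_algebras.

Section conditional_expectation.
Context {d : measure_display} {T : measurableType d} {R : realType}.
Variable mu : {measure set T -> \bar R}.
Implicit Types (D : set (set T)) (f h : T -> R).

Definition is_cond_exp D f h : Prop :=
  [/\ measurable_fun [set: g_sigma_algebraType D] h,
      mu.-integrable [set: T] (EFin \o h) &
      forall B, D B ->
        (\int[mu]_(x in B) (f x)%:E = \int[mu]_(x in B) (h x)%:E)%E].

(* A chosen version of E(f | D). Versions exist for integrable f, D a
   sub-sigma-algebra and mu finite; they agree almost everywhere. *)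
Definition cond_exp D f : T -> R := xget (cst 0) [set h | is_cond_exp D f h].

Definition cond_exp_perp D f : T -> R := f \- cond_exp D f.

Definition orthogonal_cvg (phi : R -> R) (A : nat -> set (set T)) D : Prop :=
  forall S : nat -> set T, (forall n, A n (S n)) ->
    orlicz_weak_cvg0 mu phi (fun n => cond_exp_perp D \1_(S n)).

End conditional_expectation.

(* Main.v *)
From HB Require Import structures.
From mathcomp Require Import all_boot all_order all_algebra.
From mathcomp Require Import all_classical all_reals all_analysis.
From mathcomp Require Import measurable_realfun ring lra.
Require Import Defs.

Set Implicit Arguments.
Unset Strict Implicit.
Unset Printing Implicit Defensive.

Import Order.TTheory GRing.Theory Num.Theory.
Import numFieldNormedType.Exports.

Local Open Scope classical_set_scope.
Local Open Scope ring_scope.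

(* Write D for the lower limit and E_n, E_D for the conditional expectations
   given A_n and D.

   Two facts about conditional expectations carry the proof. First, E_n h -> h
   in L^1 for every bounded D-measurable h: the sets whose indicators have this
   property form a Dynkin system containing the pi-system of the sets that
   belong to all but finitely many of the A_n, and this pi-system generates D.
   Second, for g = f - E_D f with f bounded and S_n = {E_n g >= 0}, which
   belongs to A_n, one has int |E_n g| = 2 int_{S_n} g, and int_{S_n} g is the
   pairing of E_D^perp(1_{S_n}) with g. Orthogonal convergence therefore gives
   E_n f -> E_D f in L^1 for bounded f; as the E_n f are uniformly bounded and
   phi lies below its chords, convergence of the modulars int phi(c .) follows.
   The general case is reached by truncating f: Delta_2 makes int phi(c (f - f_j))
   tend to 0, and Jensen's inequality carries this bound over to E_n and E_D.

   Conversely, for S_n in A_n and g bounded, the pairing of E_D^perp(1_{S_n})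
   with g equals int_{S_n} (E_n g - E_D g), at most the L^1 distance of E_n g
   and E_D g; elements of L^psi are L^1 limits of bounded functions. *)

(** * Bounded functions measurable for a sub-sigma-algebra *)

Section sub_sigma_algebra_measurability.
Context {d : measure_display} {T : measurableType d} {R : realType}.
Implicit Types (D : set (set T)) (f g h b : T -> R).

Lemma sub_sigma_algebraE D : is_sub_sigma_algebra D -> <<s D >> = D.
Proof. by move=> [sD _]; exact: sigma_algebra_id. Qed.

Lemma sub_sigma_algebra_preimage D f (Y : set R) : is_sub_sigma_algebra D ->
  measurable_fun [set: g_sigma_algebraType D] f -> measurable Y ->
  D (f @^-1` Y).
Proof.
move=> HD mf mY; rewrite -[X in X _](sub_sigma_algebraE HD).
by rewrite -[_ @^-1` _]setTI; exact: mf.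
Qed.

Lemma sub_sigma_algebra_measurable_fun D f : is_sub_sigma_algebra D ->
  measurable_fun [set: g_sigma_algebraType D] f -> measurable_fun [set: T] f.
Proof.
move=> HD mf _ Y mY; rewrite setTI; apply: HD.2.
exact: sub_sigma_algebra_preimage.
Qed.

Lemma sub_sigma_algebra_indic D (B : set T) : is_sub_sigma_algebra D -> D B ->
  measurable_fun [set: g_sigma_algebraType D] (\1_B : _ -> R).
Proof.
move=> HD DB; apply: measurable_indic.
by rewrite /measurable/= (sub_sigma_algebraE HD).
Qed.

(** The sum is [y] rounded down to a multiple of [e], written with thresholds so that for [y] a
    function value it becomes a combination of indicators of superlevel sets. *)
Lemma staircase (e y : R) (K : nat) : 0 < e -> 0 <= y <= K%:R * e ->
  `|y - \sum_(j < K) e * ((j.+1%:R * e <= y)%R : bool)%:R| <= e.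
Proof.
move=> e0 /andP[y0 yK].
set s := \sum_(j < K) _.
(* The induction on [K] needs both regimes: as long as [y] lies above [K%:R * e] every threshold
   counts, and afterwards the sum has stayed within [e] of [y]. *)
suff [sy _ /(_ yK)] : [/\ s <= y, K%:R * e <= y -> s = K%:R * e &
    y <= K%:R * e -> y - e <= s].
  by move=> ys; rewrite ler_norml; apply/andP; split; lra.
rewrite /s {s yK}; elim: K => [|K [IH1 IH2 IH3]].
  by rewrite big_ord0 mul0r; split => //; lra.
rewrite big_ord_recr/=; have K1 : K.+1%:R * e = K%:R * e + e.
  by rewrite -natr1 mulrDl mul1r.
rewrite K1; have [le|lt] := leP (K%:R * e + e) y.
  by rewrite IH2 ?mulr1; [split=> *; lra|lra].
by rewrite mulr0 addr0; split => // ?; lra.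
Qed.

(** Step functions on superlevel sets are uniformly dense in the bounded [D]-measurable functions,
    so closure under uniform approximation is enough and no monotone limit occurs. *)
Lemma bounded_measurable_ind D (P : (T -> R) -> Prop) :
  is_sub_sigma_algebra D ->
  (forall B, D B -> P \1_B) ->
  (forall f g, P f -> P g -> P (f \+ g)) ->
  (forall k f, P f -> P (fun x => k * f x)) ->
  (forall f, measurable_fun [set: g_sigma_algebraType D] f ->
    (forall e, 0 < e -> exists2 g, P g & forall x, `|f x - g x| <= e) -> P f) ->
  forall f M, measurable_fun [set: g_sigma_algebraType D] f ->
    (forall x, `|f x| <= M) -> P f.
Proof.
move=> HD P1 PD PZ Plim f M mf fM.
(* The shift by [M] makes the function nonnegative, as [staircase] requires; it is undone at the end
   by adding a constant, which satisfies [P] as well. *)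
pose f' : T -> R := f \+ cst M.
have mf' : measurable_fun [set: g_sigma_algebraType D] f'.
  by apply: measurable_funD => //; exact: measurable_cst.
have DT : D setT.
  rewrite -(sub_sigma_algebraE HD).
  exact: (@measurableT _ (g_sigma_algebraType D)).
have Pc k : P (cst k).
  rewrite (_ : cst k = fun x => k * \1_setT x); first by apply/PZ/P1.
  by apply/funext => x; rewrite indicT mulr1.
suff Pf' : P f'.
  rewrite (_ : f = f' \+ cst (- M)); first exact: PD.
  by apply/funext => x /=; rewrite addrK.
apply: Plim => // e e0.
have /archi_boundP : 0 <= `|M + M| / e by rewrite divr_ge0// ltW.
set K := Num.bound _ => MK.
have fK x : 0 <= f' x <= K%:R * e.
  have := fM x; rewrite ler_norml /f'/= => /andP[h1 h2].
  apply/andP; split; first lra.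
  rewrite ltr_pdivrMr// in MK; apply: le_trans (ltW MK).
  by apply: le_trans (ler_norm _); lra.
pose U (j : nat) := f' @^-1` `[j.+1%:R * e, +oo[%classic.
exists (fun x => \sum_(j < K) e * \1_(U j) x).
  elim: (K) => [|k IH].
    rewrite (_ : (fun _ => _) = cst 0)//.
    by apply/funext => x; rewrite big_ord0.
  rewrite (_ : (fun _ => _) = (fun x => \sum_(j < k) e * \1_(U j) x) \+
     (fun x => e * \1_(U k) x)); last first.
    by apply/funext => x /=; rewrite big_ord_recr.
  apply: PD => //; apply/PZ/P1.
  exact: sub_sigma_algebra_preimage.
move=> x; under eq_bigr do rewrite indicE.
have UE j : (x \in U j) = (j.+1%:R * e <= f' x).
  by apply/idP/idP; rewrite inE /U/= in_itv/= andbT.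
under eq_bigr do rewrite UE.
exact: staircase.
Qed.

End sub_sigma_algebra_measurability.

(** * Integrability and bounded multipliers on a finite measure space *)

Section bounded_integrals.
Context {d : measure_display} {T : measurableType d} {R : realType}.
Variable mu : {finite_measure set T -> \bar R}.
Implicit Types f g b : T -> R.
Local Notation intg f := (mu.-integrable [set: T] (EFin \o f)).

Let bounded_bnd b M : (forall x, `|b x| <= M) -> [bounded b x | x in [set: T]].
Proof.
move=> bM; exists M; split; first exact: num_real.
by move=> y My x _; exact: le_trans (bM x) (ltW My).
Qed.

Lemma integrable_bounded f M :
  measurable_fun [set: T] f -> (forall x, `|f x| <= M) -> intg f.
Proof.
move=> mf fM; apply: measurable_bounded_integrable => //.
  by rewrite ltey_eq fin_num_measure.
exact: bounded_bnd fM.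
Qed.

Lemma integrable_mul_bounded b f M :
  measurable_fun [set: T] b -> (forall x, `|b x| <= M) -> intg f ->
  intg (fun x => b x * f x).
Proof. by move=> mb /bounded_bnd bM; exact: integrableMr. Qed.

Lemma integrable_comp_norm f : intg f -> intg (fun x => `|f x|).
Proof. exact: integrable_norm. Qed.

Lemma integrable_sub f g : intg f -> intg g -> intg (fun x => f x - g x).
Proof. by move=> ? ?; apply: (integrableB measurableT (f := EFin \o f) (g := EFin \o g)). Qed.

Lemma integrable_add f g : intg f -> intg g -> intg (fun x => f x + g x).
Proof. by move=> ? ?; apply: (integrableD measurableT (f := EFin \o f) (g := EFin \o g)). Qed.

Lemma integrable_scale k f : intg f -> intg (fun x => k * f x).
Proof. exact: (@integrableZl _ _ _ mu _ measurableT k (EFin \o f)). Qed.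

Lemma le_Rintegral_bounded_mul b f e : 0 <= e ->
  measurable_fun [set: T] b -> (forall x, `|b x| <= e) -> intg f ->
  `|\int[mu]_x (b x * f x)| <= e * \int[mu]_x `|f x|.
Proof.
move=> e0 mb be fi; have bfi := integrable_mul_bounded mb be fi.
apply: (le_trans (le_normr_Rintegral measurableT bfi)).
rewrite -RintegralZl//; last exact: integrable_comp_norm.
apply: le_Rintegral => //; first exact: integrable_comp_norm.
  exact/integrable_scale/integrable_comp_norm.
by move=> x _; rewrite normrM ler_wpM2r.
Qed.

End bounded_integrals.

(** * Existence and basic properties of conditional expectations *)

Section trim.
Local Open Scope ereal_scope.
Context {d : measure_display} {T : measurableType d} {R : realType}.
Variable mu : {finite_measure set T -> \bar R}.
Variables (D : set (set T)) (HD : is_sub_sigma_algebra D).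

Lemma measurable_trim (B : set (g_sigma_algebraType D)) :
  measurable B -> d.-measurable B.
Proof. by rewrite /measurable/= sub_sigma_algebraE//; exact: HD.2. Qed.

Lemma measurable_fun_trim :
  measurable_fun [set: T] (id : T -> g_sigma_algebraType D).
Proof. by move=> _ B mB; rewrite setTI; exact: measurable_trim mB. Qed.

(* The dummy argument makes the measure and charge instances, whose proofs need
   it, inferable. *)
Definition trim of is_sub_sigma_algebra D :=
  pushforward mu (id : T -> g_sigma_algebraType D).

Let trim0 : trim HD set0 = 0. Proof. exact: (measure0 mu). Qed.

Let trim_ge0 A : 0 <= trim HD A. Proof. exact: (measure_ge0 mu). Qed.

Let trim_sigma_additive : semi_sigma_additive (trim HD).
Proof.
move=> F mF tF mUF; apply: (measure_semi_sigma_additive (s := mu)) => //.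
- by move=> n; exact: measurable_trim (mF n).
- exact: measurable_trim mUF.
Qed.

HB.instance Definition _ := isMeasure.Build _ _ _ (trim HD)
  trim0 trim_ge0 trim_sigma_additive.

Let trim_fin : fin_num_fun (trim HD).
Proof. by move=> A mA; apply: (fin_num_measure mu); exact: measurable_trim mA. Qed.

HB.instance Definition _ := Measure_isFinite.Build _ _ _ (trim HD) trim_fin.

Variables (f : T -> \bar R) (fi : mu.-integrable [set: T] f).

(** The signed measure sending [B] in [D] to the integral of [f] over [B]; its density with respect
    to [trim] is the conditional expectation. *)
Definition trim_charge of is_sub_sigma_algebra D :=
  pushforward (induced_charge fi) (id : T -> g_sigma_algebraType D).

Let trim_charge0 : trim_charge HD set0 = 0. Proof. exact: (charge0 (induced_charge fi)). Qed.

Let trim_charge_fin A : measurable A -> trim_charge HD A \is a fin_num.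
Proof.
move=> mA; apply: (fin_num_measure (induced_charge fi)).
exact: measurable_trim mA.
Qed.

Let trim_charge_sigma_additive : semi_sigma_additive (trim_charge HD).
Proof.
move=> F mF tF mUF; apply: (charge_semi_sigma_additive (s := induced_charge fi)) => //.
- by move=> n; exact: measurable_trim (mF n).
- exact: measurable_trim mUF.
Qed.

HB.instance Definition _ := isCharge.Build _ _ _ (trim_charge HD)
  trim_charge0 trim_charge_fin trim_charge_sigma_additive.

Lemma trim_charge_dominates : trim_charge HD `<< trim HD.
Proof.
apply/null_content_dominatesP => A mA muA.
apply: null_set_integral => //; first exact: measurable_trim.
exact: measurable_funTS (measurable_int _ fi).
Qed.

End trim.

Section cond_exp_theory.
Context {d : measure_display} {T : measurableType d} {R : realType}.
Variable mu : {finite_measure set T -> \bar R}.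
Implicit Types (D : set (set T)) (f g h b : T -> R).
Local Notation intg f := (mu.-integrable [set: T] (EFin \o f)).

(** The Radon-Nikodym derivative of [trim_charge] with respect to [trim] is a version, so the choice
    made by [cond_exp] does not fall back on its default value. *)
Lemma cond_expP D f : is_sub_sigma_algebra D -> intg f ->
  is_cond_exp mu D f (cond_exp mu D f).
Proof.
move=> HD fi; apply: (@xgetPex _ (cst 0) (is_cond_exp mu D f)).
have dom := @trim_charge_dominates _ _ _ mu D HD _ fi.
have gi := Radon_Nikodym_integrable dom.
have gE A := @Radon_Nikodym_integral _ _ _ _ _ A dom.
have gfin x := Radon_Nikodym_fin_num x dom.
set g := Radon_Nikodym _ _ in gi gE gfin.
(* The density is finite everywhere, so [fine] loses nothing. *)
exists (fine \o g).
have gK : EFin \o (fine \o g) = g by apply/funext => x /=; rewrite fineK.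
have mg := measurable_int _ gi.
have mg' : measurable_fun [set: T] (g : T -> \bar R).
  move=> _ Y mY; rewrite setTI; apply: (measurable_trim HD).
  by rewrite -[X in measurable X]setTI; exact: mg.
have gi' : mu.-integrable [set: T] (g : T -> \bar R).
  apply/integrableP; split => //; move/integrableP : gi => [_].
  rewrite ge0_integral_pushforward//; first exact: measurable_fun_trim.
  exact: measurableT_comp.
split.
- by apply: measurableT_comp => //; exact: measurable_fine.
- by rewrite gK.
- move=> B DB; have mB : measurable (B : set (g_sigma_algebraType D)).
    by rewrite /measurable/= sub_sigma_algebraE.
  under [RHS]eq_integral do rewrite -[(fine _)%:E]/((EFin \o (fine \o g)) _) gK.
  transitivity (trim_charge fi HD B); first by [].
  rewrite gE//.
  rewrite integral_pushforward//; first exact: measurable_fun_trim.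
  by apply: integrableS gi' => //; exact: (measurable_trim HD).
Qed.

Lemma is_cond_exp_sub D f g hf hg : intg f -> intg g ->
  is_sub_sigma_algebra D ->
  is_cond_exp mu D f hf -> is_cond_exp mu D g hg ->
  is_cond_exp mu D (fun x => f x - g x) (fun x => hf x - hg x).
Proof.
move=> fi gi HD [mhf hfi hfE] [mhg hgi hgE]; split.
- exact: measurable_funB.
- exact: integrable_sub.
- move=> B DB; have mB := HD.2 _ DB.
  have iB k : intg k -> mu.-integrable B (EFin \o k) by apply: integrableS.
  rewrite integralB_EFin//; [|exact: iB..].
  by rewrite integralB_EFin//; [|exact: iB..]; rewrite hfE// hgE.
Qed.

Lemma is_cond_exp_add D f g hf hg : intg f -> intg g ->
  is_sub_sigma_algebra D ->
  is_cond_exp mu D f hf -> is_cond_exp mu D g hg ->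
  is_cond_exp mu D (fun x => f x + g x) (fun x => hf x + hg x).
Proof.
move=> fi gi HD [mhf hfi hfE] [mhg hgi hgE]; split.
- exact: measurable_funD.
- exact: integrable_add.
- move=> B DB; have mB := HD.2 _ DB.
  have iB k : intg k -> mu.-integrable B (EFin \o k) by apply: integrableS.
  rewrite integralD_EFin//; [|exact: iB..].
  by rewrite integralD_EFin//; [|exact: iB..]; rewrite hfE// hgE.
Qed.

Lemma is_cond_exp_scale D k f h : intg f -> is_sub_sigma_algebra D ->
  is_cond_exp mu D f h ->
  is_cond_exp mu D (fun x => k * f x) (fun x => k * h x).
Proof.
move=> fi HD [mh hi hE]; split.
- exact: measurable_funM.
- exact: integrable_scale.
- move=> B DB; have mB := HD.2 _ DB.
  have iB g : intg g -> mu.-integrable B (EFin \o g) by apply: integrableS.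
  under eq_integral do rewrite EFinM; under [RHS]eq_integral do rewrite EFinM.
  by rewrite !integralZl//; [rewrite hE|exact: iB..].
Qed.

Lemma is_cond_exp_id D f : is_sub_sigma_algebra D ->
  measurable_fun [set: g_sigma_algebraType D] f -> intg f ->
  is_cond_exp mu D f f.
Proof. by move=> HD mf fi; split. Qed.

Lemma is_cond_exp_Rintegral_indic D f h (B : set T) :
  is_sub_sigma_algebra D -> D B -> is_cond_exp mu D f h ->
  \int[mu]_x (\1_B x * f x) = \int[mu]_x (\1_B x * h x).
Proof.
have E (k : T -> R) : \int[mu]_x (\1_B x * k x) = fine (\int[mu]_(x in B) (k x)%:E)%E.
  congr fine; rewrite [RHS]integral_mkcond; apply: eq_integral => x _.
  by rewrite patchE indicE; case: (x \in B); rewrite ?mul1r ?mul0r.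
by move=> HD DB [_ _ hE]; rewrite !E hE.
Qed.

(** For indicators this is the defining property; the functional induction extends it to bounded
    multipliers. All later uses of conditional expectations as projections go through this
    identity. *)
Lemma is_cond_exp_Rintegral_mul D f h b M : is_sub_sigma_algebra D ->
  intg f -> is_cond_exp mu D f h ->
  measurable_fun [set: g_sigma_algebraType D] b -> (forall x, `|b x| <= M) ->
  \int[mu]_x (b x * f x) = \int[mu]_x (b x * h x).
Proof.
move=> HD fi cE mb bM; have hi : intg h by case: cE.
(* Measurability and boundedness are part of the predicate, so that the products in the closure
   steps are integrable. *)
pose P b := [/\ measurable_fun [set: g_sigma_algebraType D] b,
  exists M, forall x, `|b x| <= M &
  \int[mu]_x (b x * f x) = \int[mu]_x (b x * h x)].
suff [] : P b by [].
have Pint c k : P c -> intg k -> intg (fun x => c x * k x).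
  move=> [mc [N cN] _]; apply: (integrable_mul_bounded _ cN).
  exact: (sub_sigma_algebra_measurable_fun HD).
apply: (bounded_measurable_ind HD _ _ _ _ mb bM).
- move=> B DB; split; first exact: sub_sigma_algebra_indic.
    by exists 1 => x; rewrite indicE; case: (x \in B); rewrite ?normr1 ?normr0.
  exact: is_cond_exp_Rintegral_indic cE.
- move=> u v Pu Pv; have [mu_ [Mu uM] uE] := Pu; have [mv [Mv vM] vE] := Pv.
  split; first exact: measurable_funD.
    by exists (Mu + Mv) => x; rewrite (le_trans (ler_normD _ _))// lerD.
  under eq_Rintegral do rewrite mulrDl; under [RHS]eq_Rintegral do rewrite mulrDl.
  by rewrite !RintegralD//; [rewrite uE vE|exact: Pint..].
- move=> k u Pu; have [mu_ [Mu uM] uE] := Pu; split; first exact: measurable_funM.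
    by exists (`|k| * Mu) => x; rewrite normrM ler_wpM2l.
  under eq_Rintegral do rewrite -mulrA; under [RHS]eq_Rintegral do rewrite -mulrA.
  by rewrite !RintegralZl//; [rewrite uE|exact: Pint..].
- move=> u mu_ uapprox.
  have mu' := sub_sigma_algebra_measurable_fun HD mu_.
  (* A single approximation at distance [1] already shows that [u] is bounded. *)
  have [v0 [_ [V0 v0V] _] uv0] := uapprox _ ltr01.
  have uM x : `|u x| <= 1 + V0.
    rewrite -(subrK (v0 x) (u x)) (le_trans (ler_normD _ _))// lerD//.
  split => //; first by exists (1 + V0).
  apply/eqP; rewrite -subr_eq0 -normr_eq0 eq_le normr_ge0 andbT.
  apply/ler_addgt0Pr => e e0; rewrite add0r.
  (* The errors for [f] and for [h] add up to [e / (N + 1) * N], which is at most [e]; the [+ 1]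
     covers the case [N = 0]. *)
  pose N := \int[mu]_x `|f x| + \int[mu]_x `|h x|.
  have N0 : 0 <= N by rewrite addr_ge0// Rintegral_ge0.
  have e'0 : 0 < e / (N + 1) by rewrite divr_gt0// ltr_wpDl.
  have [v Pv uv] := uapprox _ e'0; have [mv [V vV] vE] := Pv.
  have mv' := sub_sigma_algebra_measurable_fun HD mv.
  have H k : intg k -> `|\int[mu]_x (u x * k x) - \int[mu]_x (v x * k x)| <=
      e / (N + 1) * \int[mu]_x `|k x|.
    move=> ki; rewrite -RintegralB//; [|exact: integrable_mul_bounded uM ki|exact: Pint].
    under eq_Rintegral do rewrite -mulrBl.
    apply: le_Rintegral_bounded_mul => //; first exact: ltW.
    exact: measurable_funB.
  rewrite (_ : _ - _ = (\int[mu]_x (u x * f x) - \int[mu]_x (v x * f x)) -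
    (\int[mu]_x (u x * h x) - \int[mu]_x (v x * h x))); last by rewrite vE; ring.
  rewrite (le_trans (ler_normB _ _))// (le_trans (lerD (H _ fi) (H _ hi)))//.
  by rewrite -mulrDr -/N mulrAC ler_pdivrMr ?ltr_wpDl// ler_wpM2l ?lerDl ?ltW.
Qed.

End cond_exp_theory.

(** * Jensen's inequality *)

Section jensen.
Context {d : measure_display} {T : measurableType d} {R : realType}.
Variable mu : {finite_measure set T -> \bar R}.
Implicit Types (D : set (set T)) (f g h b : T -> R).
Local Notation intg f := (mu.-integrable [set: T] (EFin \o f)).

Lemma integrable_Rintegral f : intg f ->
  (\int[mu]_x (f x)%:E = (\int[mu]_x f x)%:E)%E.
Proof. by move=> fi; rewrite fineK//; exact: integrable_fin_num. Qed.

(* Any selection of subgradients is nondecreasing, hence measurable and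
   bounded on bounded sets. *)
Lemma is_cond_exp_jensen D f h (phi : R -> R) : is_sub_sigma_algebra D ->
  intg f -> is_cond_exp mu D f h -> measurable_fun [set: R] phi ->
  (forall x, 0 <= phi x) ->
  (forall x, exists p, forall y, phi x + p * (y - x) <= phi y) ->
  (\int[mu]_x (phi (h x))%:E <= \int[mu]_x (phi (f x))%:E)%E.
Proof.
move=> HD fi cE mphi phi0 /choice[p pP]; have [mh hi _] := cE.
have mh' := sub_sigma_algebra_measurable_fun HD mh.
(* Adding the subgradient inequalities at [x] and at [y] gives [(p y - p x) * (y - x) >= 0]. *)
have p_nd : {homo p : x y / x <= y}.
  move=> x y; rewrite le_eqVlt => /predU1P[->//|xy].
  have := pP x y; have := pP y x => h1 h2.
  rewrite -subr_ge0 -(@pmulr_lge0 _ (y - x)) ?subr_gt0//.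
  by nra.
have mp : measurable_fun [set: R] p by exact: nondecreasing_measurable.
(* On the [D]-sets where [|h| <= n] the subgradient [p (h x)] is bounded and may serve as a
   multiplier; monotone convergence in [n] then removes the restriction. *)
pose F (n : nat) := h @^-1` `[- n%:R, n%:R]%classic.
have FE n x : (x \in F n) = (`|h x| <= n%:R).
  by rewrite ler_norml; apply/idP/idP; rewrite inE /F/= in_itv.
have DF n : D (F n) by exact: sub_sigma_algebra_preimage.
have mF n : measurable (F n) by exact: HD.2.
suff key n : (\int[mu]_(x in F n) (phi (h x))%:E <= \int[mu]_x (phi (f x))%:E)%E.
  have FT : \bigcup_n F n = setT.
    rewrite -subTset => x _; have /archi_boundP := normr_ge0 (h x).
    set n := Num.bound _ => hn; exists n => //.
    by rewrite /F/= in_itv/= -ler_norml ltW.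
  have mphih : measurable_fun [set: T] (EFin \o (phi \o h)).
    by apply/measurable_EFinP; exact: measurableT_comp.
  have ndF : nondecreasing_seq F.
    move=> m n mn; apply/subsetPset => x; rewrite /F/= !in_itv/= -!ler_norml.
    by move=> /le_trans; apply; rewrite ler_nat.
  have := @ge0_nondecreasing_set_cvg_integral _ _ _ F (EFin \o (phi \o h)) mu ndF mF
    (fun i => measurable_funTS mphih)
    (fun i x _ => (phi0 (h x) : 0 <= (EFin \o (phi \o h)) x)%E).
  rewrite FT => cvgF; rewrite -(cvg_lim _ cvgF)//.
  apply: lime_le; first by apply/cvg_ex; eexists; exact: cvgF.
  exact: nearW.
have [phify|] := eqVneq (\int[mu]_x (phi (f x))%:E)%E +oo%E.
  by rewrite phify leey.
rewrite -ltey => phify.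
have phifi : intg (phi \o f).
  apply/integrableP; split.
    apply/measurable_EFinP/measurableT_comp => //.
    exact/measurable_EFinP/(measurable_int mu).
  by under eq_integral do rewrite /= ger0_norm//.
(* The subgradient inequality at [h x], evaluated at [f x] and restricted to [F n], is integrated;
   its linear term [b * (f - h)] has integral zero because [b] is bounded and [D]-measurable. *)
pose b x := \1_(F n) x * p (h x).
pose M := `|p n%:R| + `|p (- n%:R)|.
have M0 : 0 <= M by rewrite addr_ge0.
have pM x : `|x| <= n%:R -> `|p x| <= M.
  rewrite ler_norml => /andP[/p_nd + /p_nd] => h1 h2.
  rewrite ler_norml; apply/andP; split.
    rewrite lerNl (le_trans (_ : _ <= - p (- n%:R)))// ?lerN2//.
    by rewrite (le_trans (ler_norm _))// normrN lerDr.
  by rewrite (le_trans h2)// (le_trans (ler_norm _))// lerDl.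
have bM x : `|b x| <= M.
  rewrite /b indicE FE; case: (leP `|h x| n%:R) => hx.
    by rewrite mul1r pM.
  by rewrite mul0r normr0.
have mb : measurable_fun [set: g_sigma_algebraType D] b.
  apply: measurable_funM; first exact: sub_sigma_algebra_indic.
  exact: measurableT_comp.
have mb' := sub_sigma_algebra_measurable_fun HD mb.
pose u x := \1_(F n) x * phi (h x).
have mu' : measurable_fun [set: T] u.
  by apply: measurable_funM; [exact: measurable_indic|exact: measurableT_comp].
(* The bound comes from the subgradient inequality at [h x] evaluated at [0]. *)
have uM x : `|u x| <= phi 0 + M * n%:R.
  rewrite /u indicE FE; case: (leP `|h x| n%:R) => hx; last first.
    by rewrite mul0r normr0 addr_ge0// mulr_ge0.
  rewrite mul1r ger0_norm//; have := pP (h x) 0; rewrite sub0r mulrN lerBlDr.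
  move=> /le_trans; apply; rewrite lerD2l (le_trans (ler_norm _))// normrM.
  by rewrite ler_pM// pM.
have ui : intg u := integrable_bounded mu mu' uM.
have bfi := integrable_mul_bounded mb' bM fi.
have bhi := integrable_mul_bounded mb' bM hi.
rewrite (_ : (\int[mu]_(x in F n) _ = \int[mu]_x (u x)%:E)%E); last first.
  rewrite integral_mkcond; apply: eq_integral => x _.
  by rewrite patchE /u indicE; case: (x \in F n); rewrite ?mul1r ?mul0r.
rewrite (integrable_Rintegral ui) (integrable_Rintegral phifi) lee_fin.
have := is_cond_exp_Rintegral_mul HD fi cE mb bM => bE.
suff : \int[mu]_x u x + (\int[mu]_x (b x * f x) - \int[mu]_x (b x * h x)) <=
    \int[mu]_x phi (f x).
  by rewrite bE subrr addr0.
rewrite -RintegralB// -RintegralD//; last exact: integrable_sub.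
apply: le_Rintegral => //; first by apply: integrable_add => //; exact: integrable_sub.
move=> x _; rewrite /u /b -mulrA -mulrA -mulrBr -mulrDr indicE -mulrBr.
by case: (x \in F n); rewrite ?mul1r ?mul0r.
Qed.

(** Jensen's inequality for the absolute value, which has the sign as a subgradient. *)
Lemma is_cond_exp_L1 D f h : is_sub_sigma_algebra D -> intg f ->
  is_cond_exp mu D f h -> \int[mu]_x `|h x| <= \int[mu]_x `|f x|.
Proof.
move=> HD fi cE; have [_ hi _] := cE.
rewrite -lee_fin -!integrable_Rintegral; [|exact: integrable_comp_norm..].
apply: (is_cond_exp_jensen (phi := Num.norm) HD fi cE) => //.
move=> x; exists (Num.sg x) => y; rewrite mulrBr -normrEsg addrCA subrr addr0.
rewrite (le_trans (ler_norm _))// normrM ler_piMl// normr_sg.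
by case: (_ != _).
Qed.

(** Taken with [f = g], it also says that two versions of one conditional expectation are at L^1
    distance zero. *)
Lemma is_cond_exp_L1_sub D f g hf hg : is_sub_sigma_algebra D ->
  intg f -> intg g -> is_cond_exp mu D f hf -> is_cond_exp mu D g hg ->
  \int[mu]_x `|hf x - hg x| <= \int[mu]_x `|f x - g x|.
Proof.
move=> HD fi gi cf cg; apply: (is_cond_exp_L1 HD).
  exact: integrable_sub.
exact: is_cond_exp_sub.
Qed.

(** Truncation to the interval from [-M] to [M], for [0 <= M]. It serves both to truncate [f] and to
    turn versions that are bounded only almost everywhere into bounded ones. *)
Definition clamp (M x : R) : R := Num.max (- M) (Num.min x M).

Lemma clamp_norm M x : 0 <= M -> `|clamp M x| <= M.
Proof.
move=> M0; rewrite ler_norml /clamp le_max lexx/= ge_max ge_min lexx orbT andbT.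
lra.
Qed.

Lemma clamp_id M x : `|x| <= M -> clamp M x = x.
Proof.
by rewrite ler_norml => /andP[Mx xM]; rewrite /clamp (min_idPl xM) (max_idPr Mx).
Qed.

Lemma clamp_sub_norm M x : 0 <= M -> `|x - clamp M x| <= `|x|.
Proof.
move=> M0; rewrite /clamp; case: (leP x M) => xM.
  case: (leP (- M) x) => Mx; first by rewrite subrr normr0.
  by rewrite opprK !ler0_norm; lra.
by case: (leP (- M) M) => Mx; [rewrite !ger0_norm; lra|lra].
Qed.

Lemma measurable_clamp {d'} {T' : measurableType d'} M (f : T' -> R) :
  measurable_fun [set: T'] f -> measurable_fun [set: T'] (fun x => clamp M (f x)).
Proof.
by move=> mf; apply: measurable_maxr => //; exact: measurable_minr.
Qed.

(** Jensen's inequality for the convex function [max (|x| - M) 0]: it vanishes on the values of [f],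
    hence almost everywhere on those of [h]. *)
Lemma is_cond_exp_ae_bounded D f h (M : R) : is_sub_sigma_algebra D -> intg f ->
  is_cond_exp mu D f h -> (forall x, `|f x| <= M) ->
  ae_eq mu [set: T] h (fun x => clamp M (h x)).
Proof.
move=> HD fi cE fM; have [mh hi _] := cE.
have mh' := sub_sigma_algebra_measurable_fun HD mh.
pose phi (x : R) : R := Num.max (`|x| - M) 0.
have mphi : measurable_fun [set: R] phi.
  by apply: measurable_maxr => //; apply: measurable_funB.
have phi0 x : 0 <= phi x by rewrite /phi le_max lexx orbT.
have phiM x : `|x| - M <= phi x by rewrite /phi le_max lexx.
have phi_eq0 x : `|x| <= M -> phi x = 0.
  by move=> xM; rewrite /phi (max_idPr _)// subr_le0.
have := is_cond_exp_jensen (phi := phi) HD fi cE mphi phi0.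
rewrite [X in (_ -> (_ <= X)%E)](_ : _ = 0%E); last first.
  by apply: integral0_eq => x _; rewrite phi_eq0.
have sub x : exists p, forall y, phi x + p * (y - x) <= phi y.
  have [xM|xM] := leP `|x| M.
    by exists 0 => y; rewrite mul0r addr0 phi_eq0.
  exists (Num.sg x) => y; rewrite (le_trans _ (phiM y))//.
  rewrite /phi (max_idPl _); last by rewrite subr_ge0 ltW.
  suff : Num.sg x * y <= `|y| by rewrite mulrBr -normrEsg; lra.
  rewrite (le_trans (ler_norm _))// normrM ler_piMl// normr_sg.
  by case: (_ != _).
move=> /(_ sub) phih0.
have mphih : measurable_fun [set: T] (fun x => (phi (h x))%:E).
  by apply/measurable_EFinP; exact: measurableT_comp.
have : (\int[mu]_x `|(phi (h x))%:E| = 0)%E.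
  under eq_integral do rewrite /= ger0_norm//.
  by apply/eqP; rewrite eq_le phih0 integral_ge0// => x _; rewrite lee_fin.
move/(ae_eq_integral_abs mu measurableT mphih); apply: filterS => x /= + _.
move=> /(_ I) [hx0]; rewrite clamp_id// -subr_le0 -hx0; exact: phiM.
Qed.

Lemma ae_eq_Rintegral f g : measurable_fun [set: T] f ->
  measurable_fun [set: T] g -> ae_eq mu [set: T] f g ->
  \int[mu]_x f x = \int[mu]_x g x.
Proof.
move=> mf mg fg; congr fine; apply: ae_eq_integral => //.
- exact/measurable_EFinP.
- exact/measurable_EFinP.
- by apply: filterS fg => x /= + _ => /(_ I) ->.
Qed.

(** Supplies versions bounded at every point, which multipliers and test functions have to be. *)
Lemma bounded_is_cond_exp D f h (M : R) : 0 <= M -> is_sub_sigma_algebra D ->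
  intg f -> is_cond_exp mu D f h -> (forall x, `|f x| <= M) ->
  is_cond_exp mu D f (fun x => clamp M (h x)).
Proof.
move=> M0 HD fi cE fM; have [mh hi hE] := cE.
have mc : measurable_fun [set: g_sigma_algebraType D] (fun x => clamp M (h x)).
  exact: measurable_clamp.
have mh' := sub_sigma_algebra_measurable_fun HD mh.
have mc' := sub_sigma_algebra_measurable_fun HD mc.
split => //.
  by apply: (integrable_bounded mu mc') => x; exact: clamp_norm.
move=> B DB; have mB := HD.2 _ DB.
rewrite hE//; apply: ae_eq_integral => //.
- by apply/measurable_EFinP; exact: measurable_funTS.
- by apply/measurable_EFinP; exact: measurable_funTS.
- apply: filterS (is_cond_exp_ae_bounded HD fi cE fM) => x /= + _.
  by move=> /(_ I) {1}->.
Qed.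

End jensen.

(** * Convergence in L^1 *)

Section L1_convergence.
Context {d : measure_display} {T : measurableType d} {R : realType}.
Variable mu : {finite_measure set T -> \bar R}.
Implicit Types (D : set (set T)) (f g h b u v w : T -> R).
Local Notation intg f := (mu.-integrable [set: T] (EFin \o f)).

Lemma cond_exp_integrable D f : is_sub_sigma_algebra D -> intg f ->
  intg (cond_exp mu D f).
Proof. by move=> HD /(cond_expP HD)[]. Qed.

Lemma Rintegral_norm_le_add u v w : intg u -> intg v -> intg w ->
  (forall x, `|u x| <= `|v x| + `|w x|) ->
  \int[mu]_x `|u x| <= \int[mu]_x `|v x| + \int[mu]_x `|w x|.
Proof.
move=> ui vi wi uvw; rewrite -RintegralD//; [|exact: integrable_comp_norm..].
apply: le_Rintegral => //; first exact: integrable_comp_norm.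
by apply: integrable_add; exact: integrable_comp_norm.
Qed.

Lemma Rintegral_norm_ge0 u : 0 <= \int[mu]_x `|u x|.
Proof. exact: Rintegral_ge0. Qed.

Lemma cvg0_squeeze (a b : nat -> R) : (forall n, 0 <= a n <= b n) ->
  b @ \oo --> 0 -> a @ \oo --> 0.
Proof.
move=> ab b0; apply: (squeeze_cvgr (f := cst 0)); [exact: nearW|exact: cvg_cst|exact: b0].
Qed.

Variables (A : nat -> set (set T)) (A_sub : forall n, is_sub_sigma_algebra (A n)).

Lemma tail_sub_sigma_algebra m : is_sub_sigma_algebra (\bigcap_(n >= m) A n).
Proof.
split; first by apply: sigma_algebra_bigcap => n _; exact: (A_sub n).1.
by move=> B /(_ m) Bm; apply: (A_sub m).2; apply: Bm => /=.
Qed.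

Lemma lower_limit_sub_sigma_algebra : is_sub_sigma_algebra (lower_limit A).
Proof.
split; first exact: smallest_sigma_algebra.
apply: smallest_sub; first exact: sigma_algebra_measurable.
by move=> B [m _ /(tail_sub_sigma_algebra m).2].
Qed.

(** These functions are shown to form a closed linear subspace of L^1 containing the indicators of
    sets in [lower_limit A]. The limit is [g] itself, so the lower limit enters only through those
    indicators. *)
Let fixed g := intg g /\ (\int[mu]_x `|cond_exp mu (A n) g x - g x| @[n --> \oo] --> (0 : R)).

Let fixed_add f g : fixed f -> fixed g -> fixed (f \+ g).
Proof.
move=> [fi f0] [gi g0]; have fgi := integrable_add fi gi; split => //.
have Ei n k : intg k -> intg (cond_exp mu (A n) k) by exact: cond_exp_integrable.
apply: (@cvg0_squeeze _ (fun n => \int[mu]_x `|cond_exp mu (A n) f x - f x| +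
    \int[mu]_x `|cond_exp mu (A n) g x - g x|)); last first.
  by rewrite -[X in _ --> X]addr0; exact: cvgD.
move=> n; rewrite Rintegral_norm_ge0/=.
(* The chosen version for the sum need not be the sum of the chosen versions; it is only at L^1
   distance zero from it, whence the extra term in the triangle inequality. *)
have fgn := is_cond_exp_add fi gi (A_sub n) (cond_expP (A_sub n) fi) (cond_expP (A_sub n) gi).
have := is_cond_exp_L1_sub (A_sub n) fgi fgi (cond_expP (A_sub n) fgi) fgn.
under [leRHS]eq_Rintegral do rewrite subrr normr0.
rewrite Rintegral_cst// mul0r => h0.
rewrite -[leRHS]add0r (le_trans _ (lerD h0 (lexx _)))//.
pose w x := (cond_exp mu (A n) f x - f x) + (cond_exp mu (A n) g x - g x).
have wi : intg w by apply: integrable_add; apply: integrable_sub => //; exact: Ei.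
rewrite (@le_trans _ _ (\int[mu]_x `|cond_exp mu (A n) (f \+ g) x -
    (cond_exp mu (A n) f x + cond_exp mu (A n) g x)| + \int[mu]_x `|w x|))//.
  apply: Rintegral_norm_le_add => //.
  - by apply: integrable_sub => //; exact: Ei.
  - by apply: integrable_sub; [exact: Ei|apply: integrable_add; exact: Ei].
  - move=> x; rewrite (le_trans _ (ler_normD _ _))// /w/=.
    by rewrite le_eqVlt; apply/orP; left; apply/eqP; congr `|_|; ring.
rewrite lerD2l; apply: Rintegral_norm_le_add => //.
- by apply: integrable_sub => //; exact: Ei.
- by apply: integrable_sub => //; exact: Ei.
- by move=> x; exact: ler_normD.
Qed.

Let fixed_scale k f : fixed f -> fixed (fun x => k * f x).
Proof.
move=> [fi f0]; have kfi := integrable_scale k fi; split => //.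
have Ei n g : intg g -> intg (cond_exp mu (A n) g) by exact: cond_exp_integrable.
apply: (@cvg0_squeeze _ (fun n =>
    `|k| * \int[mu]_x `|cond_exp mu (A n) f x - f x|)); last first.
  by rewrite -[X in _ --> X](mulr0 `|k|); apply: cvgM => //; exact: cvg_cst.
move=> n; rewrite Rintegral_norm_ge0/=.
have kn := is_cond_exp_scale k fi (A_sub n) (cond_expP (A_sub n) fi).
have := is_cond_exp_L1_sub (A_sub n) kfi kfi (cond_expP (A_sub n) kfi) kn.
under [leRHS]eq_Rintegral do rewrite subrr normr0.
rewrite Rintegral_cst// mul0r => h0.
rewrite -RintegralZl//; last by apply/integrable_comp_norm/integrable_sub => //; exact: Ei.
under [leRHS]eq_Rintegral do rewrite -normrM mulrBr.
rewrite -[leRHS]add0r (le_trans _ (lerD h0 (lexx _)))//.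
apply: Rintegral_norm_le_add => //.
- by apply: integrable_sub => //; exact: Ei.
- by apply: integrable_sub; [exact: Ei|apply: integrable_scale; exact: Ei].
- by apply: integrable_sub => //; apply: integrable_scale; exact: Ei.
- by move=> x; rewrite (le_trans _ (ler_normD _ _))// addrA subrK.
Qed.

(** Split [E_n f - f] into [E_n f - E_n g], [E_n g - g] and [g - f]; the first part is controlled by
    the last, [E_n] being an L^1 contraction. *)
Let fixed_closed f : intg f ->
  (forall e, 0 < e -> exists2 g, fixed g & \int[mu]_x `|f x - g x| <= e) ->
  fixed f.
Proof.
move=> fi fapprox; split => //; apply/cvgr0Pnorm_le => e e0.
have Ei n g : intg g -> intg (cond_exp mu (A n) g) by exact: cond_exp_integrable.
have e30 : 0 < e / 3 by rewrite divr_gt0.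
have [g [gi /cvgr0Pnorm_le g0] fg] := fapprox _ e30.
have := g0 _ e30; apply: filterS => n; rewrite !ger0_norm ?Rintegral_norm_ge0// => gn.
have gf : \int[mu]_x `|g x - f x| <= e / 3.
  by under eq_Rintegral do rewrite distrC.
have Efg := is_cond_exp_L1_sub (A_sub n) fi gi
  (cond_expP (A_sub n) fi) (cond_expP (A_sub n) gi).
rewrite (_ : e = e / 3 + (e / 3 + e / 3)); last by field.
rewrite (le_trans _ (lerD (le_trans Efg fg) (lerD gn gf)))//.
rewrite (le_trans _ (lerD (lexx _) (@Rintegral_norm_le_add
  (fun x => cond_exp mu (A n) g x - g x + (g x - f x)) _ _ _ _ _ _)))//.
- apply: Rintegral_norm_le_add => //.
  + by apply: integrable_sub => //; exact: Ei.
  + by apply: integrable_sub; exact: Ei.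
  + by apply: integrable_add; apply: integrable_sub => //; exact: Ei.
  + move=> x; rewrite (le_trans _ (ler_normD _ _))//.
    by rewrite le_eqVlt; apply/orP; left; apply/eqP; congr `|_|; ring.
- by apply: integrable_add; apply: integrable_sub => //; exact: Ei.
- by apply: integrable_sub => //; exact: Ei.
- exact: integrable_sub.
- by move=> x; exact: ler_normD.
Qed.

(** From rank [m] on, the indicator is a version of its own conditional expectation, so the sequence
    is eventually zero. *)
Let fixed_tail m (B : set T) : (\bigcap_(n >= m) A n) B -> fixed \1_B.
Proof.
move=> AB; have mB := (tail_sub_sigma_algebra m).2 _ AB.
have Bi : intg (\1_B : T -> R) by exact: integrable_indic.
split => //; apply: cvg_near_cst; near=> n.
have AnB : A n B by apply: AB => /=; near: n; exact: nbhs_infty_ge.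
apply/eqP; rewrite eq_le Rintegral_norm_ge0 andbT.
have cB : is_cond_exp mu (A n) \1_B \1_B.
  by apply: is_cond_exp_id => //; exact: sub_sigma_algebra_indic.
rewrite (le_trans (is_cond_exp_L1_sub (A_sub n) Bi Bi (cond_expP (A_sub n) Bi) cB))//.
under [leLHS]eq_Rintegral do rewrite subrr normr0.
by rewrite Rintegral_cst// mul0r.
Unshelve. all: by end_near. Qed.

(** The finite unions [G n] are handled by additivity. What they miss, [H n], decreases to the empty
    set, so its measure tends to zero and closedness applies. *)
Let fixed_bigcup (F : (set T)^nat) : (forall n, measurable (F n)) ->
  trivIset [set: nat] F -> (forall n, fixed (\1_(F n) : T -> R)) ->
  fixed (\1_(\bigcup_k F k) : T -> R).
Proof.
move=> mF tF fF; have mU : measurable (\bigcup_k F k) by exact: bigcup_measurable.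
have ind B : measurable B -> intg (\1_B : T -> R) by exact: integrable_indic.
pose G n := \bigcup_(k < n) F k.
have mG n : measurable (G n) by apply: bigcup_measurable.
have fG n : fixed (\1_(G n) : T -> R).
  elim: n => [|n IH].
    rewrite /G bigcup_mkord big_ord0.
    rewrite (_ : \1__ = fun x => 0 * \1_(F 0%N) x); first exact: fixed_scale.
    by apply/funext => x; rewrite mul0r indic0.
  rewrite (_ : \1__ = \1_(G n) \+ \1_(F n)); first exact: fixed_add.
  apply/funext => x; rewrite /G bigcup_mkord big_ord_recr/= -bigcup_mkord -/(G n).
  rewrite !indicE in_setU; case: (boolP (x \in G n)) => [|_]; last by rewrite add0r.
  rewrite inE => -[k /= kn Fkx]; rewrite (_ : (x \in F n) = false) ?addr0//.
  apply: memNset => Fnx; have /(_ I I) kn' := tF k n.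
  by move: kn; rewrite kn' ?ltnn//; exists x.
apply: fixed_closed => [|e e0]; first exact: ind.
pose H n := (\bigcup_k F k) `\` G n.
have mH n : measurable (H n) by exact: measurableD.
have cvgH : mu (H n) @[n --> \oo] --> 0%E.
  rewrite -(measure0 mu) (_ : set0 = \bigcap_n H n); last first.
    apply/esym; rewrite -subset0 => x Hx; have [[k _ Fk] _] := Hx 0%N Logic.I.
    have [_] := Hx k.+1 Logic.I; apply; exists k => //=.
  apply: nonincreasing_cvg_mu => //.
  - by rewrite ltey_eq fin_num_measure.
  - exact: bigcap_measurable.
  - move=> m n mn; apply/subsetPset => x [Ux nG]; split => // -[k km Fk].
    by apply: nG; exists k => //=; exact: leq_trans km mn.
have /fine_cvgP[_ /cvgr0Pnorm_le /(_ _ e0)] := cvgH.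
move=> [n _ /(_ n (leqnn n))/=]; rewrite ger0_norm ?fine_ge0// => He.
exists (\1_(G n)) => //; apply: le_trans He.
rewrite le_eqVlt; apply/orP; left; apply/eqP; congr fine.
rewrite -[in RHS](setIT (H n)) -integral_indic//; apply: eq_integral => x _.
rewrite !indicE /H in_setD; congr EFin.
have GF : x \in G n -> x \in \bigcup_k F k.
  by rewrite !inE => -[k _ Fk]; exists k.
case: (x \in G n) GF => [->//|_]; first by rewrite subrr normr0.
by case: (x \in _); rewrite ?subr0 ?normr1 ?normr0.
Qed.

(** Dynkin induction on the pi-system [G] of sets that lie in all [A n] from some rank on; the
    larger of two ranks serves for an intersection. *)
Let fixed_indic (B : set T) : lower_limit A B -> fixed (\1_B : T -> R).
Proof.
pose G := \bigcup_m (\bigcap_(n >= m) A n).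
have measG C : <<s G >> C -> measurable C.
  by move=> GC; apply: lower_limit_sub_sigma_algebra.2.
apply: (@dynkin_induction _ (g_sigma_algebraType G) G
  (fun B => fixed (\1_B : T -> R))) => //.
- move=> B1 B2 [m1 _ AB1] [m2 _ AB2]; exists (maxn m1 m2) => // n /=.
  rewrite geq_max => /andP[m1n m2n].
  rewrite -(sub_sigma_algebraE (A_sub n)).
  apply: (@measurableI _ (g_sigma_algebraType (A n))); apply: sub_sigma_algebra.
    exact: AB1.
  exact: AB2.
- apply: (@fixed_tail 0) => n _; rewrite -(sub_sigma_algebraE (A_sub n)).
  exact: (@measurableT _ (g_sigma_algebraType (A n))).
- by move=> C [m _ AC]; exact: (@fixed_tail m).
- move=> C mC fC.
  rewrite (_ : \1__ = \1_setT \+ (fun x => -1 * \1_C x)); last first.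
    apply/funext => x /=; rewrite !indicE in_setC in_setT.
    by case: (x \in C); rewrite ?mulr1 ?subrr ?mulr0 ?addr0.
  apply: fixed_add; last exact: fixed_scale.
  apply: (@fixed_tail 0) => n _; rewrite -(sub_sigma_algebraE (A_sub n)).
  exact: (@measurableT _ (g_sigma_algebraType (A n))).
- move=> F mF tF fF; apply: fixed_bigcup => // n.
  exact: measG (mF n).
Qed.

Lemma lower_limit_cond_exp_cvg g (M : R) :
  measurable_fun [set: g_sigma_algebraType (lower_limit A)] g ->
  (forall x, `|g x| <= M) ->
  \int[mu]_x `|cond_exp mu (A n) g x - g x| @[n --> \oo] --> (0 : R).
Proof.
move=> mg gM; have HD := lower_limit_sub_sigma_algebra.
suff [] : fixed g by [].
apply: (bounded_measurable_ind HD fixed_indic fixed_add fixed_scale _ mg gM).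
move=> f mf fapprox; have mf' := sub_sigma_algebra_measurable_fun HD mf.
have fi : intg f.
  have [h [hi _] fh] := fapprox _ ltr01.
  rewrite (_ : f = fun x => (f x - h x) + h x); last by apply/funext => x; rewrite subrK.
  apply: integrable_add => //; apply: (integrable_bounded mu _ fh).
  by apply: measurable_funB => //; apply/measurable_EFinP/(measurable_int mu).
apply: fixed_closed => // e e0.
(* On a space of mass [c], uniform distance [e / (c + 1)] gives L^1 distance at most [e], also when
   [c = 0]. *)
pose c := fine (mu setT).
have c0 : 0 <= c by rewrite fine_ge0.
have [h fh fhe] := fapprox (e / (c + 1)) ltac:(by rewrite divr_gt0// ltr_wpDl).
exists h => //; have [hi _] := fh.
rewrite (@le_trans _ _ (\int[mu]_(x in setT) (e / (c + 1))))//.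
  apply: le_Rintegral => //; first exact/integrable_comp_norm/integrable_sub.
  exact: finite_measure_integrable_cst.
by rewrite Rintegral_cst// -/c mulrAC ler_pdivrMr ?ltr_wpDl// ler_wpM2l ?lerDl ?ltW.
Qed.

(** Self-adjointness of [E_D]: the integrals of [E_D 1_S * g], [E_D 1_S * E_D g] and [1_S * E_D g]
    agree. *)
Lemma Rintegral_cond_exp_perp D (S : set T) g h (M : R) : is_sub_sigma_algebra D ->
  measurable S -> measurable_fun [set: T] g -> (forall x, `|g x| <= M) ->
  is_cond_exp mu D g h -> (forall x, `|h x| <= M) ->
  \int[mu]_x (cond_exp_perp mu D \1_S x * g x) = \int[mu]_x (\1_S x * (g x - h x)).
Proof.
move=> HD mS mg gM cg hM; have [mh hi _] := cg.
have gi : intg g := integrable_bounded mu mg gM.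
have Si : intg (\1_S : T -> R) by exact: integrable_indic.
have S1 x : `|\1_S x : R| <= 1.
  by rewrite indicE; case: (x \in S); rewrite ?normr1 ?normr0.
have cS := cond_expP HD Si; have [mc ci _] := cS.
have mS' : measurable_fun [set: T] (\1_S : T -> R) by exact: measurable_indic.
have cbi := bounded_is_cond_exp ler01 HD Si cS S1.
have cae := is_cond_exp_ae_bounded HD Si cS S1.
have [mcb _ _] := cbi.
have mcb' := sub_sigma_algebra_measurable_fun HD mcb.
have mc' := sub_sigma_algebra_measurable_fun HD mc.
have cb1 x := clamp_norm (cond_exp mu D \1_S x) (@ler01 R).
(* The chosen version is replaced by its truncation, a bounded multiplier. *)
transitivity (\int[mu]_x (\1_S x * g x - clamp 1 (cond_exp mu D \1_S x) * g x)).
  apply: ae_eq_Rintegral.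
  - by apply: measurable_funM => //; exact: measurable_funB.
  - by apply: measurable_funB; exact: measurable_funM.
  - apply: filterS cae => x /= + _ => /(_ I) {1}<-.
    by rewrite /cond_exp_perp/= mulrBl.
rewrite RintegralB//; first last.
  exact: integrable_mul_bounded mcb' cb1 gi.
  exact: integrable_mul_bounded mS' S1 gi.
rewrite (is_cond_exp_Rintegral_mul HD gi cg mcb cb1).
under [X in _ - X]eq_Rintegral do rewrite mulrC.
rewrite -(is_cond_exp_Rintegral_mul HD Si cbi mh hM).
under [RHS]eq_Rintegral do rewrite mulrBr.
under [X in _ - X = _]eq_Rintegral do rewrite mulrC.
rewrite RintegralB//.
  exact: integrable_mul_bounded mS' S1 gi.
exact: integrable_mul_bounded mS' S1 hi.
Qed.

Let D := lower_limit A.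

(* Pairing [E(g | A n)], for [g = f - E(f | D)], with the sign of
   [E(g | A n)], which is [A n]-measurable. *)
Lemma orthogonal_cond_exp_cvg f (M : R) :
  (forall S g, (forall n, A n (S n)) -> measurable_fun [set: T] g ->
    (exists N, forall x, `|g x| <= N) ->
    \int[mu]_x (cond_exp_perp mu D \1_(S n) x * g x) @[n --> \oo] --> (0 : R)) ->
  measurable_fun [set: T] f -> (forall x, `|f x| <= M) -> 0 <= M ->
  \int[mu]_x `|cond_exp mu (A n) f x - cond_exp mu D f x| @[n --> \oo] --> (0 : R).
Proof.
move=> Horth mf fM M0; have HD := lower_limit_sub_sigma_algebra.
have fi : intg f := integrable_bounded mu mf fM.
have cf := cond_expP HD fi; have [mcf cfi _] := cf.
(* A version of [E(f | D)] bounded everywhere, so that [g = f - fD] is an admissible test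
   function. *)
pose fD x := clamp M (cond_exp mu D f x).
have cfD : is_cond_exp mu D f fD by exact: bounded_is_cond_exp.
have aefD := is_cond_exp_ae_bounded HD fi cf fM; rewrite -/(fD) in aefD.
have fDM x : `|fD x| <= M by exact: clamp_norm.
have [mfD fDi _] := cfD.
have mfD' := sub_sigma_algebra_measurable_fun HD mfD.
pose g x := f x - fD x.
have mg : measurable_fun [set: T] g by exact: measurable_funB.
have gi : intg g by exact: integrable_sub.
have gM x : `|g x| <= M + M by rewrite (le_trans (ler_normB _ _))// lerD.
have cg0 : is_cond_exp mu D g (fun x => fD x - fD x).
  by apply: is_cond_exp_sub => //; exact: is_cond_exp_id.
have zM x : `|fD x - fD x| <= M + M by rewrite subrr normr0 addr_ge0.
pose w n x := cond_exp mu (A n) f x - cond_exp mu (A n) fD x.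
have cw n : is_cond_exp mu (A n) g (w n).
  by apply: is_cond_exp_sub => //; exact: cond_expP.
pose S n := w n @^-1` `[0, +oo[%classic.
have AS n : A n (S n).
  by have [mw _ _] := cw n; exact: sub_sigma_algebra_preimage.
have mS n : measurable (S n) by exact: (A_sub n).2.
have S1 n x : `|\1_(S n) x : R| <= 1.
  by rewrite indicE; case: (x \in _); rewrite ?normr1 ?normr0.
(* The sign of [w n], with value [1] where [w n] vanishes. *)
pose s n x : R := 2 * \1_(S n) x - 1.
have wE n x : `|w n x| = s n x * w n x.
  rewrite /s indicE; case: (boolP (x \in S n)) => xS.
    move: xS; rewrite inE /S/= in_itv/= andbT => w0.
    by rewrite ger0_norm// mulr1; ring.
  rewrite mulr0 ltr0_norm; first by ring.
  rewrite ltNge; apply: contraNN xS => w0.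
  by rewrite inE /S/= in_itv/= w0.
have sM n x : `|s n x| <= 3.
  by rewrite (le_trans (ler_normB _ _))// normrM normr1 ger0_norm//; have := S1 n x; lra.
have ms n : measurable_fun [set: g_sigma_algebraType (A n)] (s n).
  apply: measurable_funB => //; apply: measurable_funM => //.
  exact: sub_sigma_algebra_indic.
(* As [s n] is [A n]-measurable, [s n * w n] and [s n * g] have the same integral. The latter is
   twice the integral of [g] over [S n], since [g] has integral zero; as [E(g | D) = 0], the
   integral over [S n] is the pairing. *)
have wint n : \int[mu]_x `|w n x| =
    2 * \int[mu]_x (cond_exp_perp mu D \1_(S n) x * g x).
  under eq_Rintegral do rewrite wE.
  rewrite -(is_cond_exp_Rintegral_mul (A_sub n) gi (cw n) (ms n) (sM n)).
  rewrite (Rintegral_cond_exp_perp HD (mS n) mg gM cg0 zM).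
  have Sgi : intg (fun x => \1_(S n) x * g x).
    by apply: (integrable_mul_bounded _ (S1 n)) => //; exact: measurable_indic.
  under [X in _ = _ * X]eq_Rintegral do rewrite subrr subr0.
  rewrite -RintegralZl//.
  have g0 : \int[mu]_x g x = 0.
    have cst1 (x : T) : `|cst 1 x : R| <= 1 by rewrite normr1.
    have := is_cond_exp_Rintegral_mul HD gi cg0 (measurable_cst _) cst1.
    under eq_Rintegral do rewrite mul1r.
    by under [in X in _ = X -> _]eq_Rintegral do rewrite subrr mulr0;
      rewrite Rintegral_cst// mul0r.
  rewrite -[RHS]subr0 -g0 -RintegralB//; last exact: integrable_scale.
  by apply: eq_Rintegral => x _; rewrite /s mulrBl mul1r mulrA.
(* Here [E_n f - fD] is split as [E_n (f - fD)] plus [E_n fD - fD]; the second part tends to zero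
   because [fD] is measurable for the lower limit. *)
apply: (@cvg0_squeeze _ (fun n => \int[mu]_x `|w n x| +
    \int[mu]_x `|cond_exp mu (A n) fD x - fD x|)); last first.
  rewrite -[X in _ --> X]addr0; apply: cvgD; last exact: lower_limit_cond_exp_cvg mfD fDM.
  rewrite (funext wint) -(mulr0 2); apply: cvgM; first exact: cvg_cst.
  by apply: Horth => //; exists (M + M).
move=> n; rewrite Rintegral_norm_ge0/=.
have Ei k : intg k -> intg (cond_exp mu (A n) k) by exact: cond_exp_integrable.
rewrite (_ : \int[mu]_x _ = \int[mu]_x `|cond_exp mu (A n) f x - fD x|).
  apply: Rintegral_norm_le_add.
  - by apply: integrable_sub => //; exact: Ei.
  - by apply: integrable_sub; exact: Ei.
  - by apply: integrable_sub => //; exact: Ei.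
  - move=> x; rewrite (le_trans _ (ler_normD _ _))// /w.
    by rewrite le_eqVlt; apply/orP; left; apply/eqP; congr `|_|; ring.
have mEf : measurable_fun [set: T] (cond_exp mu (A n) f).
  by apply/measurable_EFinP; apply: (measurable_int mu); exact: Ei.
apply: ae_eq_Rintegral.
- apply: measurableT_comp => //; apply: measurable_funB => //.
  exact: (sub_sigma_algebra_measurable_fun HD mcf).
- by apply: measurableT_comp => //; exact: measurable_funB.
- by apply: filterS aefD => x /= + _ => /(_ I) ->.
Qed.

(** Since [S n] belongs to [A n], replacing [g] by [E(g | A n)] does not change its integral over
    [S n]; the pairing is then bounded by an L^1 distance. *)
Lemma cond_exp_cvg_orthogonal (S : nat -> set T) g (M : R) :
  (forall n, A n (S n)) -> measurable_fun [set: T] g ->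
  (forall x, `|g x| <= M) -> 0 <= M ->
  \int[mu]_x `|cond_exp mu (A n) g x - cond_exp mu D g x| @[n --> \oo] --> (0 : R) ->
  \int[mu]_x (cond_exp_perp mu D \1_(S n) x * g x) @[n --> \oo] --> (0 : R).
Proof.
move=> AS mg gM M0 cvgg; have HD := lower_limit_sub_sigma_algebra.
have gi : intg g := integrable_bounded mu mg gM.
have mS n : measurable (S n) by exact: (A_sub n).2.
have S1 n x : `|\1_(S n) x : R| <= 1.
  by rewrite indicE; case: (x \in _); rewrite ?normr1 ?normr0.
have cg := cond_expP HD gi.
have cgb := bounded_is_cond_exp M0 HD gi cg gM.
have aeg := is_cond_exp_ae_bounded HD gi cg gM.
have [mcg cgi _] := cg; have [mcgb cgbi _] := cgb.
apply/norm_cvg0P; apply: cvg0_squeeze cvgg => n; rewrite normr_ge0/=.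
have cn := cond_expP (A_sub n) gi; have [mcn cni _] := cn.
have gbM x := clamp_norm (cond_exp mu D g x) M0.
rewrite (Rintegral_cond_exp_perp HD (mS n) mg gM cgb gbM).
have mSn : measurable_fun [set: T] (\1_(S n) : T -> R) by exact: measurable_indic.
have Sbi k : intg k -> intg (fun x => \1_(S n) x * k x).
  by move=> ki; exact: (integrable_mul_bounded mSn (S1 n)).
under eq_Rintegral do rewrite mulrBr.
rewrite RintegralB//; [|exact: Sbi..].
have mSA := sub_sigma_algebra_indic (R := R) (A_sub n) (AS n).
rewrite (is_cond_exp_Rintegral_mul (A_sub n) gi cn mSA (S1 n)).
rewrite -RintegralB//; [|exact: Sbi..].
under eq_Rintegral do rewrite -mulrBr.
have cngb : intg (fun x => cond_exp mu (A n) g x - clamp M (cond_exp mu D g x)).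
  exact: integrable_sub.
rewrite (le_trans (le_Rintegral_bounded_mul ler01 mSn (S1 n) cngb))// mul1r.
rewrite le_eqVlt; apply/orP; left; apply/eqP; apply: ae_eq_Rintegral.
- by apply/measurable_EFinP/(measurable_int mu); exact: integrable_comp_norm.
- by apply/measurable_EFinP/(measurable_int mu); apply/integrable_comp_norm/integrable_sub.
- by apply: filterS aeg => x /= + _ => /(_ I) {2}->.
Qed.

End L1_convergence.

(** * Young functions *)

Section young.
Context {R : realType}.
Variable phi : R -> R.
Hypothesis phiY : young_function phi.

Lemma young0 : phi 0 = 0.
Proof. by apply/(young_eq0 phiY). Qed.

Lemma young_conv (t x y : R) : 0 <= t -> t <= 1 ->
  phi (t * x + (1 - t) * y) <= t * phi x + (1 - t) * phi y.
Proof.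
move=> t0 t1; have /(_ x y) := young_convex phiY (Itv01 t0 t1).
by apply; rewrite inE.
Qed.

(** Convexity at [0], the midpoint of [x] and [- x], together with evenness. *)
Lemma young_ge0 x : 0 <= phi x.
Proof.
have h0 : 0 <= 2^-1 :> R by rewrite invr_ge0.
have h1 : 2^-1 <= 1 :> R by rewrite invf_le1// ler1n.
have := young_conv x (- x) h0 h1; rewrite (young_even phiY).
rewrite (_ : _ + _ * - x = 0); last by field.
by rewrite young0 (_ : _ + _ = phi x)//; field.
Qed.

Lemma young_norm x : phi `|x| = phi x.
Proof. by case: (ger0P x) => // _; rewrite (young_even phiY). Qed.

Lemma young_scale_le (t x : R) : 0 <= t -> t <= 1 -> phi (t * x) <= t * phi x.
Proof.
move=> t0 t1; have := young_conv x 0 t0 t1.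
by rewrite young0 !mulr0 !addr0.
Qed.

Lemma young_le_norm (x y : R) : `|x| <= `|y| -> phi x <= phi y.
Proof.
rewrite -(young_norm x) -(young_norm y) => xy.
have [y0|y0] := eqVneq y 0.
  by move: xy; rewrite y0 normr0 normr_le0 => /eqP ->; rewrite normr0.
have y0' : 0 < `|y| by rewrite normr_gt0.
rewrite (_ : `|x| = (`|x| / `|y|) * `|y|); last by rewrite divfK ?gt_eqF.
have t1 : `|x| / `|y| <= 1 by rewrite ler_pdivrMr// mul1r.
apply: le_trans (young_scale_le _ _ t1) _; first by rewrite divr_ge0.
by rewrite ler_piMl// young_ge0.
Qed.

Lemma young_measurable : measurable_fun [set: R] phi.
Proof. by apply: continuous_measurable_fun; exact: young_continuous. Qed.

Lemma young_slope (z x y : R) : z < x -> x < y ->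
  (phi x - phi z) / (x - z) <= (phi y - phi x) / (y - x).
Proof.
move=> zx xy.
have xz0 : 0 < x - z by rewrite subr_gt0.
have yx0 : 0 < y - x by rewrite subr_gt0.
have yz0 : 0 < y - z by lra.
(* The weight for which [x = t * z + (1 - t) * y]. *)
pose t := (y - x) / (y - z).
have t0 : 0 <= t by rewrite divr_ge0// ltW.
have t1 : t <= 1 by rewrite ler_pdivrMr//; lra.
have := young_conv z y t0 t1.
rewrite (_ : t * z + (1 - t) * y = x); last by rewrite /t; field; rewrite gt_eqF.
move=> h; have {}h : (y - z) * phi x <= (y - x) * phi z + (x - z) * phi y.
  rewrite (_ : _ + _ * phi y = (y - z) * (t * phi z + (1 - t) * phi y)).
    by rewrite ler_pM2l.
  by rewrite /t; field; rewrite gt_eqF.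
by rewrite ler_pdivrMr// mulrAC ler_pdivlMr//; lra.
Qed.

(** The slope is the infimum of the difference quotients to the right of [x], which the quotients to
    the left bound from below. *)
Lemma young_subgradient x : exists p, forall y, phi x + p * (y - x) <= phi y.
Proof.
pose E := [set (phi y - phi x) / (y - x) | y in [set y | x < y]].
have lbE z : z < x -> lbound E ((phi x - phi z) / (x - z)).
  by move=> zx _ [y xy <-]; exact: young_slope.
have E0 : E !=set0.
  by exists ((phi (x + 1) - phi x) / (x + 1 - x)); exists (x + 1) => //=; rewrite ltrDl.
have hlE : has_lbound E.
  by exists ((phi x - phi (x - 1)) / (x - (x - 1))); apply: lbE; rewrite ltrBlDr ltrDl.
exists (inf E) => y; have [xy|yx|->] := ltgtP x y.
- have : inf E <= (phi y - phi x) / (y - x) by apply: ge_inf => //; exists y.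
  by rewrite ler_pdivlMr ?subr_gt0//; lra.
- have : (phi x - phi y) / (x - y) <= inf E by apply: lb_le_inf => //; exact: lbE.
  by rewrite ler_pdivrMr ?subr_gt0//; lra.
- by rewrite subrr mulr0 addr0.
Qed.

Lemma young_ge_linear (a : R) : exists2 x0, 0 < x0 & forall x, x0 <= x -> a * x <= phi x.
Proof.
have /cvgryPge /(_ a) [x0 [_ h]] := young_superlinear phiY.
exists (`|x0| + 1) => [|x]; first by rewrite ltr_wpDl.
move=> x0x; have xgt : 0 < x by rewrite (lt_le_trans _ x0x)// ltr_wpDl.
rewrite -ler_pdivlMr//; apply: h.
by rewrite (lt_le_trans _ x0x)// (le_lt_trans (ler_norm _))// ltrDl.
Qed.

(** With [mu] finite, this embeds L^phi into L^1 and bounds L^1 norms by modulars. *)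
Lemma young_norm_le : exists2 C, 0 <= C & forall x, `|x| <= phi x + C.
Proof.
have [x0 x00 h] := young_ge_linear 1; exists x0; first exact: ltW.
move=> x; rewrite -young_norm; have [/h|xx0] := leP x0 `|x|.
  by rewrite mul1r => /le_trans; apply; rewrite lerDl ltW.
by rewrite (le_trans (ltW xx0))// lerDr young_ge0.
Qed.

Lemma young_third (c u v w : R) :
  phi (c * (u + v + w)) <= 3^-1 * (phi (3 * c * u) + (phi (3 * c * v) + phi (3 * c * w))).
Proof.
have h0 : 0 <= 3^-1 :> R by rewrite invr_ge0.
have h1 : 3^-1 <= 1 :> R by rewrite invf_le1// ler1n.
have k0 : 0 <= 2^-1 :> R by rewrite invr_ge0.
have k1 : 2^-1 <= 1 :> R by rewrite invf_le1// ler1n.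
have H1 := young_conv (3 * c * u) (2^-1 * (3 * c * v) + (1 - 2^-1) * (3 * c * w)) h0 h1.
have H2 := young_conv (3 * c * v) (3 * c * w) k0 k1.
rewrite (_ : c * _ = 3^-1 * (3 * c * u) +
    (1 - 3^-1) * (2^-1 * (3 * c * v) + (1 - 2^-1) * (3 * c * w))).
  by rewrite (le_trans H1)//; lra.
by field.
Qed.

(** Turns L^1 convergence of uniformly bounded functions into convergence of modulars. *)
Lemma young_le_chord (M c x : R) : 0 < M -> `|x| <= M ->
  phi (c * x) <= phi (c * M) / M * `|x|.
Proof.
move=> M0 xM; rewrite -young_norm normrM.
have t1 : `|x| / M <= 1 by rewrite ler_pdivrMr// mul1r.
have t0 : 0 <= `|x| / M by rewrite divr_ge0// ltW.
rewrite (_ : `|c| * `|x| = `|x| / M * (`|c| * M)); last by field; rewrite gt_eqF.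
apply: (le_trans (young_scale_le _ t0 t1)).
have -> : phi (`|c| * M) = phi (c * M).
  by rewrite -[RHS]young_norm normrM (gtr0_norm M0).
by rewrite mulrC mulrA mulrAC.
Qed.

(** The threshold of [Delta2] is traded for an additive constant, which is integrable because [mu]
    is finite. *)
Lemma Delta2_double : Delta2 phi ->
  exists2 k, 0 < k & exists2 C, 0 <= C & forall x, phi (2 * x) <= k * phi x + C.
Proof.
move=> [k [x0 [k0 x00 h]]]; exists k => //; exists (phi (2 * x0)); first exact: young_ge0.
move=> x; have [x0x|xx0] := leP x0 `|x|.
  rewrite -young_norm normrM ger0_norm// -(young_norm x) (le_trans (h _ x0x))//.
  by rewrite lerDl young_ge0.
rewrite (@le_trans _ _ (phi (2 * x0)))//.
  by apply: young_le_norm; rewrite !normrM ler_wpM2l// [leRHS]gtr0_norm// ltW.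
by rewrite lerDr mulr_ge0// ?young_ge0// ltW.
Qed.

(** * The complementary function *)

Let psi := complementary phi.
Let psi_set (y : R) := [set x * `|y| - phi x | x in [set x : R | 0 <= x]].

(** Superlinearity makes the terms nonpositive beyond some [x0]. Without an upper bound, the real
    [sup] would not be a true supremum. *)
Let psi_has_ubound y : has_ubound (psi_set y).
Proof.
have [x0 x00 h] := young_ge_linear `|y|; exists (x0 * `|y|) => _ [x /= xge0 <-].
have [/h|xx0] := leP x0 x.
  by rewrite mulrC => ?; rewrite (@le_trans _ _ 0)// ?subr_le0// mulr_ge0// ltW.
rewrite (@le_trans _ _ (x * `|y|))//; first by rewrite gerBl young_ge0.
by rewrite ler_wpM2r// ltW.
Qed.

Lemma complementary_ge x y : 0 <= x -> x * `|y| - phi x <= psi y.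
Proof. by move=> x0; apply: ub_le_sup; [exact: psi_has_ubound|exists x]. Qed.

Lemma complementary_ge0 y : 0 <= psi y.
Proof.
by have := complementary_ge y (lexx 0); rewrite mul0r young0 subrr.
Qed.

Lemma complementary_le_norm x y : `|x| <= `|y| -> psi x <= psi y.
Proof.
move=> xy; apply: ge_sup.
  by exists (0 * `|x| - phi 0); exists 0 => //=.
move=> _ [z /= z0 <-]; apply: le_trans (complementary_ge y z0).
by rewrite lerD2r ler_wpM2l.
Qed.

(** The function depends only on the absolute value and is monotone in it; cutting at [0] gives a
    function monotone on the whole line. *)
Lemma measurable_complementary : measurable_fun [set: R] psi.
Proof.
rewrite (_ : psi = (fun x => psi (Num.max x 0)) \o Num.norm).
  apply: measurableT_comp => //; apply: nondecreasing_measurable => // x y xy.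
  have max0 (z : R) : 0 <= Num.max z 0 by rewrite le_max lexx orbT.
  apply: complementary_le_norm; rewrite !ger0_norm//.
  by rewrite ge_max max0 le_max xy.
apply/funext => x /=; rewrite (max_idPl _)//.
by apply/eqP; rewrite eq_le; apply/andP; split; apply: complementary_le_norm; rewrite normr_id.
Qed.

End young.

(** * Orlicz spaces *)

Section orlicz.
Context {d : measure_display} {T : measurableType d} {R : realType}.
Variable mu : {finite_measure set T -> \bar R}.
Implicit Types (D : set (set T)) (f g h w : T -> R).
Local Notation intg f := (mu.-integrable [set: T] (EFin \o f)).

Lemma integrable_measurable_fun f : intg f -> measurable_fun [set: T] f.
Proof. by move=> fi; apply/measurable_EFinP; exact: (measurable_int mu). Qed.

Lemma integrable_dominated f g : measurable_fun [set: T] f ->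
  (forall x, `|f x| <= g x) -> intg g -> intg f.
Proof.
move=> mf fg; apply: le_integrable => //; first exact/measurable_EFinP.
by move=> x _ /=; rewrite lee_fin (le_trans (fg x))// ler_norm.
Qed.

Lemma integral_lty_integrable f : measurable_fun [set: T] f ->
  (forall x, 0 <= f x) -> (\int[mu]_x (f x)%:E < +oo)%E -> intg f.
Proof.
move=> mf f0 foo; apply/integrableP; split; first exact/measurable_EFinP.
by under eq_integral do rewrite /= ger0_norm//.
Qed.

(** Dominated convergence: at each point the truncation is eventually inactive, and [F (f x)]
    dominates. It is applied to [phi] rescaled and to the absolute value. *)
Lemma integral_clamp_cvg (F : R -> R) f : measurable_fun [set: R] F ->
  F 0 = 0 -> (forall x y, `|x| <= `|y| -> F x <= F y) ->
  measurable_fun [set: T] f -> intg (fun x => F (f x)) ->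
  \int[mu]_x F (f x - clamp n%:R (f x)) @[n --> \oo] --> (0 : R).
Proof.
move=> mF F0 Fle mf Ffi.
have Fge0 x : 0 <= F x by rewrite -F0 Fle// normr0.
have mFn n : measurable_fun [set: T] (fun x => F (f x - clamp n%:R (f x))).
  apply: measurableT_comp => //; apply: measurable_funB => //.
  exact: measurable_clamp.
have mFn' n : measurable_fun [set: T] (fun x => (F (f x - clamp n%:R (f x)))%:E).
  by apply/measurable_EFinP; exact: mFn.
have Fcvg : {ae mu, forall x, [set: T] x ->
    (F (f x - clamp n%:R (f x)))%:E @[n --> \oo] --> cst 0%E x}.
  apply: aeW => x _; apply: cvg_near_cst; near=> n.
  rewrite clamp_id ?subrr ?F0//; near: n; exact: nbhs_infty_ger.
have Fbnd : {ae mu, forall x n, [set: T] x ->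
    (`|(F (f x - clamp n%:R (f x)))%:E| <= (EFin \o (fun x => F (f x))) x)%E}.
  by apply: aeW => x n _ /=; rewrite lee_fin ger0_norm// Fle// clamp_sub_norm.
have [_ _] := dominated_convergence measurableT mFn' (measurable_cst _) Fcvg Ffi Fbnd.
by rewrite integral0; exact: fine_cvg.
Unshelve. all: by end_near. Qed.

Variable phi : R -> R.
Hypothesis phiY : young_function phi.

Lemma measurable_young_comp c f : measurable_fun [set: T] f ->
  measurable_fun [set: T] (fun x => phi (c * f x)).
Proof.
move=> mf; apply: measurableT_comp; first exact: young_measurable.
exact: measurable_funM.
Qed.

Lemma young_integrable c f : measurable_fun [set: T] f ->
  (\int[mu]_x (phi (c * f x))%:E < +oo)%E -> intg (fun x => phi (c * f x)).
Proof.
move=> mf; apply: integral_lty_integrable; first exact: measurable_young_comp.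
by move=> x; exact: young_ge0.
Qed.

Lemma orlicz_integrable f : orlicz_space mu phi f -> intg f.
Proof.
move=> [mf [a a0 /(young_integrable mf) fi]].
have [C C0 hC] := young_norm_le phiY.
apply: (@integrable_dominated _ (fun x => a^-1 * (phi (a * f x) + C))) => //.
  move=> x; have := hC (a * f x); rewrite normrM (gtr0_norm a0) => h.
  by rewrite -(@ler_pM2l _ a)// mulVKf ?gt_eqF.
apply/integrable_scale/integrable_add => //.
exact: finite_measure_integrable_cst.
Qed.

Lemma bounded_orlicz f (M : R) : measurable_fun [set: T] f ->
  (forall x, `|f x| <= M) -> orlicz_space mu phi f.
Proof.
move=> mf fM; split => //; exists 1 => //.
apply: integrable_lty => //.
apply: (integrable_bounded mu (measurable_young_comp 1 mf) (M := phi M)) => x.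
rewrite ger0_norm ?young_ge0// mul1r young_le_norm//.
by rewrite (le_trans (fM x))// ler_norm.
Qed.

(** Integrability at the one scale [a] given by membership passes to [2 ^+ n * a] by repeated
    doubling, and so to every [c]. *)
Lemma orlicz_Delta2_integrable c f : Delta2 phi -> orlicz_space mu phi f ->
  intg (fun x => phi (c * f x)).
Proof.
move=> /(Delta2_double phiY)[k k0 [C C0 dbl]] [mf [a a0 /(young_integrable mf) fi]].
have pow n : intg (fun x => phi (2 ^+ n * a * f x)).
  elim: n => [|n IH]; first by under eq_fun do rewrite expr0 mul1r.
  apply: (@integrable_dominated _ (fun x => k * phi (2 ^+ n * a * f x) + C)).
  - exact: measurable_young_comp.
  - by move=> x; rewrite ger0_norm ?young_ge0// exprS -!mulrA dbl.
  - apply: integrable_add; first exact: integrable_scale.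
    exact: finite_measure_integrable_cst.
(* Any [n] above [|c| / a] works, because [n] is at most [2 ^+ n]. *)
have /archi_boundP := divr_ge0 (normr_ge0 c) (ltW a0).
set n := Num.bound _ => cn.
apply: integrable_dominated (pow n); first exact: measurable_young_comp.
move=> x; rewrite ger0_norm ?young_ge0//; apply: young_le_norm => //.
rewrite !normrM ler_wpM2r// (gtr0_norm a0) -ler_pdivrMr// (le_trans (ltW cn))//.
by rewrite ger0_norm ?exprn_ge0// -natrX ler_nat ltnW// ltn_expl.
Qed.

Lemma young_normK (k x : R) : 0 < k -> phi (`|x| / k) = phi (k^-1 * x).
Proof.
move=> k0; rewrite -[RHS](young_norm phiY) normrM mulrC.
by rewrite [`|k^-1|]gtr0_norm ?invr_gt0.
Qed.

(** A modular at most [1] at scale [e^-1] makes [e] admissible in the infimum defining the Luxemburg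
    norm. *)
Lemma orlicz_cvg_modular (u : nat -> T -> R) f :
  (forall e : R, 0 < e ->
    \forall n \near \oo, (\int[mu]_x (phi (e^-1 * (u n x - f x)))%:E <= 1)%E) ->
  orlicz_cvg mu phi u f.
Proof.
move=> H; have nle (e : R) : 0 < e ->
    \forall n \near \oo, (0 <= orlicz_norm mu phi (u n \- f)%R <= e%:E)%E.
  move=> e0; apply: filterS (H e e0) => n Hn; apply/andP; split.
    by apply: le_ereal_inf_tmp => _ [k [k0 _] <-]; rewrite lee_fin ltW.
  apply: ereal_inf_lbound; exists e => //; split => //.
  by under eq_integral do rewrite young_normK//.
apply/fine_cvgP; split.
  apply: filterS (nle 1 ltr01) => n /andP[n0 n1].
  by rewrite ge0_fin_numE// (le_lt_trans n1)// ltry.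
apply/cvgr0Pnorm_le => e e0; apply: filterS (nle e e0) => n /andP[n0 n1].
rewrite /= ger0_norm ?fine_ge0// -lee_fin fineK//.
by rewrite ge0_fin_numE// (le_lt_trans n1)// ltry.
Qed.

(** If [k] is admissible for [w], integrating [|w| <= k * (phi (w / k) + C)] bounds the L^1 norm by
    [k * (1 + C * mu T)]. *)
Lemma orlicz_cvg_L1 (u : nat -> T -> R) f : (forall n, intg (u n)) -> intg f ->
  orlicz_cvg mu phi u f -> \int[mu]_x `|u n x - f x| @[n --> \oo] --> (0 : R).
Proof.
move=> ui fi /fine_cvgP[ufin /cvgr0Pnorm_le u0]; apply/cvgr0Pnorm_le => e e0.
have [C C0 hC] := young_norm_le phiY.
pose m := fine (mu [set: T]); have m0 : 0 <= m by rewrite fine_ge0.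
pose K := 1 + C * m; have K0 : 0 < K by rewrite ltr_pwDl// mulr_ge0.
(* Halving makes the norm strictly smaller than [e / K], so that the infimum yields an admissible
   [k] below [e / K]. *)
have e'0 : 0 < e / K / 2 by rewrite !divr_gt0.
near=> n.
have nfin : orlicz_norm mu phi (u n \- f) \is a fin_num by near: n.
have nle : `|fine (orlicz_norm mu phi (u n \- f))| <= e / K / 2.
  by near: n; exact: u0.
have : (orlicz_norm mu phi (u n \- f)%R < (e / K)%:E)%E.
  rewrite -(fineK nfin) lte_fin (le_lt_trans (ler_norm _))// (le_lt_trans nle)//.
  by rewrite ltr_pdivrMr// ltr_pMr ?divr_gt0// ltr1n.
move=> /ereal_inf_lt[_ [k [k0 Ik] <-]]; rewrite lte_fin => ke.
rewrite ger0_norm ?Rintegral_norm_ge0//.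
have wi : intg (fun x => u n x - f x) by exact: integrable_sub.
have {}Ik : (\int[mu]_x (phi (k^-1 * (u n x - f x)))%:E <= 1)%E.
  by under eq_integral do rewrite -young_normK//.
have phii : intg (fun x => phi (k^-1 * (u n x - f x))).
  apply: (young_integrable (integrable_measurable_fun wi)).
  by rewrite (le_lt_trans Ik)// ltry.
rewrite integrable_Rintegral// lee_fin in Ik.
have Ci : intg (cst C) by exact: finite_measure_integrable_cst.
rewrite (@le_trans _ _ (\int[mu]_x (k * (phi (k^-1 * (u n x - f x)) + cst C x))))//.
  apply: le_Rintegral => //; first exact: integrable_comp_norm.
    exact/integrable_scale/integrable_add.
  move=> x _; have := hC (k^-1 * (u n x - f x)).
  rewrite normrM gtr0_norm ?invr_gt0// => h.
  by rewrite -(@ler_pM2l _ k^-1) ?invr_gt0// mulKf ?gt_eqF.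
rewrite RintegralZl//; last exact: integrable_add.
rewrite RintegralD// Rintegral_cst// -/m.
rewrite (@le_trans _ _ (k * K))//; first by rewrite ler_pM2l// lerD2r.
by rewrite -ler_pdivlMr// ltW.
Unshelve. all: by end_near. Qed.

(** Young's inequality with first argument [1] gives [|y| <= psi y + phi 1], where [psi] is the
    complementary function. *)
Lemma complementary_orlicz_integrable g :
  orlicz_space mu (complementary phi) g -> intg g.
Proof.
move=> [mg [a a0 gi]].
have mpsi : measurable_fun [set: T] (fun x => complementary phi (a * g x)).
  apply: measurableT_comp; first exact: measurable_complementary.
  exact: measurable_funM.
have {}gi := integral_lty_integrable mpsi (fun x => complementary_ge0 phiY _) gi.
apply: (@integrable_dominated _ (fun x => a^-1 * (complementary phi (a * g x) + phi 1))) => //.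
  move=> x; have := complementary_ge phiY (a * g x) (@ler01 R).
  rewrite mul1r normrM (gtr0_norm a0) lerBlDr => h.
  by rewrite -(@ler_pM2l _ a)// mulVKf ?gt_eqF.
apply/integrable_scale/integrable_add => //.
exact: finite_measure_integrable_cst.
Qed.

Lemma bounded_complementary_orlicz g (M : R) : measurable_fun [set: T] g ->
  (forall x, `|g x| <= M) -> orlicz_space mu (complementary phi) g.
Proof.
move=> mg gM; split => //; exists 1 => //.
apply: integrable_lty => //.
apply: (integrable_bounded mu (M := complementary phi M)) => [|x].
  apply: measurableT_comp; first exact: measurable_complementary.
  exact: measurable_funM.
rewrite ger0_norm ?complementary_ge0// mul1r complementary_le_norm//.
by rewrite (le_trans (gM x))// ler_norm.
Qed.

Lemma is_cond_exp_young D f h c : is_sub_sigma_algebra D -> intg f ->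
  is_cond_exp mu D f h ->
  (\int[mu]_x (phi (c * h x))%:E <= \int[mu]_x (phi (c * f x))%:E)%E.
Proof.
move=> HD fi cf.
apply: (is_cond_exp_jensen HD (integrable_scale c fi) (is_cond_exp_scale c fi HD cf)).
- exact: young_measurable.
- exact: young_ge0.
- exact: young_subgradient.
Qed.

(** The difference is split as [E_n (f - fj)], [E_n fj - E_D fj] and [E_D (fj - f)]. Jensen's
    inequality bounds the modulars of the outer terms, and the chord bound that of the middle
    one. *)
Lemma cond_exp_orlicz_cvg (A : nat -> set (set T)) D f :
  (forall n, is_sub_sigma_algebra (A n)) -> is_sub_sigma_algebra D ->
  (forall g (M : R), measurable_fun [set: T] g -> (forall x, `|g x| <= M) -> 0 <= M ->
    \int[mu]_x `|cond_exp mu (A n) g x - cond_exp mu D g x| @[n --> \oo] --> (0 : R)) ->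
  Delta2 phi -> orlicz_space mu phi f ->
  orlicz_cvg mu phi (fun n => cond_exp mu (A n) f) (cond_exp mu D f).
Proof.
move=> A_sub HD HL1 phiD2 fphi.
have avg3 (a1 a2 a3 : R) : a1 <= 1 -> a2 <= 1 -> a3 <= 1 ->
  3^-1 * (a1 + (a2 + a3)) <= 1 by lra.
apply: orlicz_cvg_modular => e e0.
have fi := orlicz_integrable fphi; have mf := integrable_measurable_fun fi.
(* The factor [3] is the cost of splitting into three terms by convexity; each modular at scale [c]
   has to be at most [1]. *)
pose c := 3 * e^-1.
have c0 : 0 < c by rewrite mulr_gt0// invr_gt0.
have tail0 : \int[mu]_x phi (c * (f x - clamp n%:R (f x))) @[n --> \oo] --> (0 : R).
  apply: (@integral_clamp_cvg (fun x => phi (c * x))) => //.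
  - by apply: measurableT_comp; [exact: young_measurable|exact: measurable_funM].
  - by rewrite mulr0 young0.
  - by move=> x y xy; apply: young_le_norm => //; rewrite !normrM ler_wpM2l.
  - exact: orlicz_Delta2_integrable.
have [j _ /(_ j (leqnn j))/=] := (cvgr0Pnorm_le _).1 tail0 1 ltr01.
pose M := j%:R : R; pose fj x := clamp M (f x); rewrite -/M.
have M0 : 0 <= M by exact: ler0n.
have mfj : measurable_fun [set: T] fj by exact: measurable_clamp.
have fjM x : `|fj x| <= M by exact: clamp_norm.
have fji : intg fj := integrable_bounded mu mfj fjM.
have ri : intg (fun x => f x - fj x) by exact: integrable_sub.
have phir : intg (fun x => phi (c * (f x - fj x))).
  apply: integrable_dominated (orlicz_Delta2_integrable c phiD2 fphi).
    exact: measurable_young_comp (integrable_measurable_fun ri).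
  move=> x; rewrite ger0_norm ?young_ge0// young_le_norm// !normrM ler_wpM2l//.
  exact: clamp_sub_norm.
move=> /(le_trans (ler_norm _)) tail1.
have {tail1} : (\int[mu]_x (phi (c * (f x - fj x)))%:E <= 1)%E.
  by rewrite integrable_Rintegral// lee_fin.
move=> tail1; have {}tail1' : (\int[mu]_x (phi (c * (fj x - f x)))%:E <= 1)%E.
  rewrite (le_trans _ tail1)// le_eqVlt; apply/orP; left; apply/eqP.
  by apply: eq_integral => x _; rewrite -opprB mulrN (young_even phiY).
(* Both [E_n fj] and [E_D fj] are bounded by [M] almost everywhere; the [+ 1] keeps [M'] positive
   when [M = 0]. *)
pose M' := M + M + 1; have M'0 : 0 < M' by rewrite ltr_wpDl// addr_ge0.
pose K := phi (c * M') / M'.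
have K0 : 0 <= K by apply: divr_ge0; [exact: young_ge0|exact: ltW].
(* An L^1 distance of at most [(K + 1)^-1] makes the middle modular at most [K / (K + 1)]. *)
have K10 : 0 < (K + 1)^-1 by rewrite invr_gt0 ltr_wpDl.
have /cvgr0Pnorm_le /(_ _ K10) := HL1 fj M mfj fjM M0.
apply: filterS => n.
move=> /(le_trans (ler_norm _)) nb.
have cfn := cond_expP (A_sub n) fi; have cfjn := cond_expP (A_sub n) fji.
have cfD := cond_expP HD fi; have cfjD := cond_expP HD fji.
have I1 := is_cond_exp_young c (A_sub n) ri
  (is_cond_exp_sub fi fji (A_sub n) cfn cfjn).
have I3 := is_cond_exp_young c HD (integrable_sub fji fi)
  (is_cond_exp_sub fji fi HD cfjD cfD).
have [_ cfni _] := cfn; have [_ cfjni _] := cfjn.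
have [_ cfDi _] := cfD; have [_ cfjDi _] := cfjD.
move: (le_trans I1 tail1) (le_trans I3 tail1') => {}I1 {}I3.
set En := cond_exp mu (A n) in nb cfn cfjn I1 cfni cfjni *.
set ED := cond_exp mu D in nb cfD cfjD I3 cfDi cfjDi *.
have bi : intg (fun x => En fj x - ED fj x) by exact: integrable_sub.
have mb := integrable_measurable_fun bi.
have I2 : (\int[mu]_x (phi (c * (En fj x - ED fj x)))%:E <= 1)%E.
  have Kbi : intg (fun x => K * `|En fj x - ED fj x|).
    exact/integrable_scale/integrable_comp_norm.
  apply: (@le_trans _ _ (\int[mu]_x (K * `|En fj x - ED fj x|)%:E)%E).
    apply: ae_ge0_le_integral => //.
    - by move=> x _; rewrite lee_fin young_ge0.
    - by apply/measurable_EFinP; exact: measurable_young_comp.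
    - by move=> x _; rewrite lee_fin mulr_ge0.
    - by apply/measurable_EFinP; exact: integrable_measurable_fun.
    - have := is_cond_exp_ae_bounded (A_sub n) fji cfjn fjM.
      apply: filterS2 (is_cond_exp_ae_bounded HD fji cfjD fjM) => x /= h1 h2 _.
      rewrite lee_fin; apply: young_le_chord => //.
      rewrite (h1 I) (h2 I) (le_trans (ler_normB _ _))// /M'.
      by rewrite (le_trans (lerD (clamp_norm _ M0) (clamp_norm _ M0)))// lerDl.
  rewrite integrable_Rintegral// lee_fin RintegralZl//; last exact: integrable_comp_norm.
  rewrite (le_trans (ler_wpM2l K0 nb))// ler_pdivrMr ?mul1r ?lerDl//.
  by rewrite ltr_wpDl.
have int k : measurable_fun [set: T] k ->
    (\int[mu]_x (phi (c * k x))%:E <= 1)%E ->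
    intg (fun x => phi (c * k x)) /\ \int[mu]_x phi (c * k x) <= 1.
  move=> mk k1; have ki : intg (fun x => phi (c * k x)).
    by apply: young_integrable => //; rewrite (le_lt_trans k1)// ltry.
  by split => //; rewrite integrable_Rintegral// lee_fin in k1.
have ui : intg (fun x => En f x - En fj x) by exact: integrable_sub.
have vi : intg (fun x => ED fj x - ED f x) by exact: integrable_sub.
have [i1 {}I1] := int _ (integrable_measurable_fun ui) I1.
have [i2 {}I2] := int _ mb I2.
have [i3 {}I3] := int _ (integrable_measurable_fun vi) I3.
have i23 := integrable_add i2 i3; have i123 := integrable_add i1 i23.
have wi : intg (fun x => En f x - ED f x) by exact: integrable_sub.
have third x : phi (e^-1 * (En f x - ED f x)) <= 3^-1 *
    (phi (c * (En f x - En fj x)) +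
     (phi (c * (En fj x - ED fj x)) + phi (c * (ED fj x - ED f x)))).
  have := young_third phiY e^-1 (En f x - En fj x) (En fj x - ED fj x) (ED fj x - ED f x).
  by rewrite (_ : _ - _ + _ + _ = En f x - ED f x)//; ring.
have wphii : intg (fun x => phi (e^-1 * (En f x - ED f x))).
  apply: integrable_dominated (integrable_scale 3^-1 i123).
    exact: measurable_young_comp (integrable_measurable_fun wi).
  by move=> x; rewrite ger0_norm ?young_ge0//; exact: third.
rewrite (integrable_Rintegral wphii) lee_fin.
apply: (le_trans (le_Rintegral measurableT wphii
  (integrable_scale 3^-1 i123) (fun x _ => third x))).
rewrite (RintegralZl _ measurableT i123) (RintegralD measurableT i1 i23).
rewrite (RintegralD measurableT i2 i3).
exact: avg3 I1 I2 I3.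
Qed.

(* The functions [cond_exp_perp mu D \1_S] are bounded by [2] almost everywhere,
   so bounded test functions can be replaced by integrable ones. *)
Lemma cond_exp_perp_pairing_cvg D (S : nat -> set T) g : is_sub_sigma_algebra D ->
  (forall n, measurable (S n)) -> intg g ->
  (forall h (M : R), measurable_fun [set: T] h -> (forall x, `|h x| <= M) -> 0 <= M ->
    \int[mu]_x (cond_exp_perp mu D \1_(S n) x * h x) @[n --> \oo] --> (0 : R)) ->
  (\int[mu]_x (cond_exp_perp mu D \1_(S n) x * g x)%:E)%E @[n --> \oo] --> 0%E.
Proof.
move=> HD mS gi Hbnd; have mg := integrable_measurable_fun gi.
have Si n : intg (\1_(S n) : T -> R) by exact: integrable_indic.
have mSn n : measurable_fun [set: T] (\1_(S n) : T -> R) by exact: measurable_indic.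
have S1 n x : `|\1_(S n) x : R| <= 1.
  by rewrite indicE; case: (x \in _); rewrite ?normr1 ?normr0.
(* The version of [cond_exp_perp] that is bounded by [2] at every point. *)
pose q n x : R := \1_(S n) x - clamp 1 (cond_exp mu D \1_(S n) x).
have mc n : measurable_fun [set: T] (cond_exp mu D \1_(S n) : T -> R).
  by have [mc _ _] := cond_expP HD (Si n); exact: (sub_sigma_algebra_measurable_fun HD).
have mq n : measurable_fun [set: T] (q n).
  by apply: measurable_funB => //; exact: measurable_clamp.
have q2 n x : `|q n x| <= 2.
  rewrite (le_trans (ler_normB _ _))//.
  by have := clamp_norm (cond_exp mu D \1_(S n) x) (@ler01 R); have := S1 n x; lra.
have qE n k : measurable_fun [set: T] k ->
    (\int[mu]_x (cond_exp_perp mu D \1_(S n) x * k x)%:E = \int[mu]_x (q n x * k x)%:E)%E.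
  move=> mk; apply: ae_eq_integral => //.
  - by apply/measurable_EFinP/measurable_funM => //; exact: measurable_funB.
  - by apply/measurable_EFinP/measurable_funM.
  - apply: filterS (is_cond_exp_ae_bounded HD (Si n) (cond_expP HD (Si n)) (S1 n)).
    by move=> x /= + _ => /(_ I) h; rewrite /cond_exp_perp/= /q -h.
have qi n k : intg k -> intg (fun x => q n x * k x).
  by move=> ki; exact: (integrable_mul_bounded (mq n) (q2 n)).
under eq_fun do rewrite qE// (integrable_Rintegral (qi _ _ gi)).
apply: cvg_EFin; first exact: nearW.
apply/cvgr0Pnorm_le => e e0.
have tail0 : \int[mu]_x `|g x - clamp n%:R (g x)| @[n --> \oo] --> (0 : R).
  apply: (@integral_clamp_cvg Num.norm) => //; first exact: normr0.
  exact: integrable_comp_norm.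
(* The truncation error of [g] is multiplied by at most [2], contributing [e / 2]. *)
have e40 : 0 < e / 4 by rewrite divr_gt0.
have [j _ /(_ j (leqnn j))/=] := (cvgr0Pnorm_le _).1 tail0 _ e40.
pose M := j%:R : R; pose gj x := clamp M (g x); rewrite -/M => tail1.
have M0 : 0 <= M by exact: ler0n.
have mgj : measurable_fun [set: T] gj by exact: measurable_clamp.
have gjM x : `|gj x| <= M by exact: clamp_norm.
have gji : intg gj := integrable_bounded mu mgj gjM.
have e20 : 0 < e / 2 by rewrite divr_gt0.
have /cvgr0Pnorm_le /(_ _ e20) := Hbnd gj M mgj gjM M0.
apply: filterS => n; rewrite {1}/Rintegral (qE n gj mgj) => jn.
rewrite /= (_ : \int[mu]_x _ = \int[mu]_x (q n x * (g x - gj x)) + \int[mu]_x (q n x * gj x)).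
  rewrite (le_trans (ler_normD _ _))// [leRHS](_ : e = 2 * (e / 4) + e / 2); last by field.
  apply: lerD jn.
  have ri : intg (fun x => g x - gj x) by exact: integrable_sub.
  rewrite (le_trans (le_Rintegral_bounded_mul _ (mq n) (q2 n) ri))// ler_pM2l//.
  by rewrite (le_trans (ler_norm _)).
rewrite -RintegralD//; [|exact/qi/integrable_sub|exact: qi].
by apply: eq_Rintegral => x _; rewrite -mulrDr subrK.
Qed.

End orlicz.

(** * Equivalence of orthogonal convergence and norm convergence *)

Theorem corollary3p9 (R : realType) (d : measure_display) (T : measurableType d)
    (mu : {finite_measure set T -> \bar R}) (mu_complete : measure_is_complete mu)
    (phi : R -> R) (phi_young : young_function phi) (phi_Delta2 : Delta2 phi)
    (A : nat -> set (set T)) (A_sub : forall n, is_sub_sigma_algebra (A n)) :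
  orthogonal_cvg mu phi A (lower_limit A) <->
  forall f : T -> R, orlicz_space mu phi f ->
    orlicz_cvg mu phi (fun n => cond_exp mu (A n) f)
      (cond_exp mu (lower_limit A) f).
Proof.
have HD := lower_limit_sub_sigma_algebra A_sub.
split=> [orth f fphi|strong S AS g gpsi].
- apply: cond_exp_orlicz_cvg => // g M mg gM M0.
  (* Bounded measurable functions lie in L^psi, so orthogonal convergence may be tested against
     them. *)
  apply: (orthogonal_cond_exp_cvg A_sub _ mg gM M0) => S h AS mh [N hN].
  have /orth /(_ h) := AS; move/(_ (bounded_complementary_orlicz mu phi_young mh hN)).
  exact: fine_cvg.
- have mS n : measurable (S n) by exact: (A_sub n).2.
  apply: cond_exp_perp_pairing_cvg => //.
    exact: (complementary_orlicz_integrable phi_young gpsi).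
  move=> h M mh hM M0; apply: (cond_exp_cvg_orthogonal A_sub AS mh hM M0).
  (* Bounded measurable functions lie in L^phi, and there norm convergence implies L^1
     convergence. *)
  have hphi := bounded_orlicz mu phi_young mh hM.
  have hi := integrable_bounded mu mh hM.
  apply: (orlicz_cvg_L1 phi_young _ _ (strong _ hphi)) => // [n|]; exact: cond_exp_integrable.
Qed.
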